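(* Let $\mathcal B$ be a chordal building set on a finite set $S\subset\mathbb N$ with $|S|=2k$, $k\ge2$, such that no connected component of $\mathcal B$ has odd cardinality. Then the number of spheres in the wedge of $(k-2)$-dimensional spheres to which $\Delta(\mathcal P_{\mathcal B})$ is homotopy equivalent (equivalently, $\dim_{\mathbb Q}\widetilde H_{k-2}(\Delta(\mathcal P_{\mathcal B});\mathbb Q)$) equals the number of alternating $\mathcal B$-permutations.
   Context: A building set on a finite set $S\subset\mathbb N$ is a collection $\mathcal B$ of nonempty subsets of $S$ containing every singleton $\{i\}$, $i\in S$, such that $I,J\in\mathcal B$ and $I\cap J\neq\emptyset$ imply $I\cup J\in\mathcal B$. Its connected components are the inclusion-maximal elements of $\mathcal B$. For $I\subseteq S$, $\mathcal B|_I=\{J\in\mathcal B:J\subseteq I\}$. $\mathcal B$ is chordal if for every $I=\{i_1<\dots<i_r\}\in\mathcal B$ and every $1<s<r$, $\{i_s,\dots,i_r\}\in\mathcal B$. $\widehat{\mathcal P}_{\mathcal B}=\{I\subseteq S:\ \mathcal B|_I\text{ has no connected component of odd cardinality}\}$, ordered by inclusion, and $\mathcal P_{\mathcal B}=\widehat{\mathcal P}_{\mathcal B}\setminus\{\emptyset,S\}$. $\Delta(P)$ denotes the order complex (simplicial complex of finite nonempty chains) of a poset $P$; under these hypotheses $\Delta(\mathcal P_{\mathcal B})$ is homotopy equivalent to a wedge of $(k-2)$-spheres. For a building set $\mathcal B$ on $S$ with $|S|=m$, a $\mathcal B$-permutation is a sequence $(x_1x_2\cdots x_m)$ listing each element of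 $S$ exactly once such that for each $1\le i\le m$, $x_i$ and $\max\{x_1,\dots,x_i\}$ lie in the same connected component of $\mathcal B|_{\{x_1,\dots,x_i\}}$. It is alternating if $x_1>x_2<x_3>x_4<\cdots$. *)

(* Defs.v *)
From HB Require Import structures.
From mathcomp Require Import all_boot all_order all_algebra.
Set Implicit Arguments. Unset Strict Implicit. Unset Printing Implicit Defensive.
Import GRing.Theory Num.Theory.
Local Open Scope ring_scope.

Section Building.
Variable N : nat.
Notation E := ('I_N).

Definition building_set (S : {set E}) (B : {set {set E}}) : Prop :=
  [/\ (forall I, I \in B -> (I != set0) && (I \subset S)),
      (forall i, i \in S -> [set i] \in B) &
      (forall I J, I \in B -> J \in B -> I :&: J != set0 -> I :|: J \in B)].

Definition restr (B : {set {set E}}) (I : {set E}) : {set {set E}} :=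
  [set J in B | J \subset I].

Definition components (B : {set {set E}}) : {set {set E}} :=
  [set J in B | [forall K in B, (J \subset K) ==> (K == J)]].

(* chordal: for I = {i_1 < ... < i_r} in B and 1 < s < r, {i_s,...,i_r} in B;
   i_s ranges exactly over the elements of I that are neither min nor max. *)
Definition chordal (B : {set {set E}}) : Prop :=
  forall I j, I \in B -> j \in I ->
    (exists2 x, x \in I & (x < j)%N) ->
    (exists2 x, x \in I & (j < x)%N) ->
    [set x in I | (j <= x)%N] \in B.

Definition Phat (S : {set E}) (B : {set {set E}}) : {set {set E}} :=
  [set I : {set E} | (I \subset S) &&
     [forall C in components (restr B I), ~~ odd #|C|]].

Definition PB (S : {set E}) (B : {set {set E}}) : {set {set E}} :=
  Phat S B :\: [set set0; S].

Definition Bperm (S : {set E}) (B : {set {set E}}) m (t : m.-tuple E) : bool :=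
  perm_eq t (enum S) &&
  [forall i : 'I_m,
     let X := [set x in take i.+1 t] in
     [exists C in components (restr B X),
        (tnth t i \in C) &&
        [exists y in C, [forall z in X, (nat_of_ord z <= nat_of_ord y)%N]]]].

(* alternating: x_1 > x_2 < x_3 > x_4 < ...  (positions counted from 0 here,
   so position i even means x_{i+1} > x_{i+2} in 1-based numbering) *)
Definition alternating m (t : m.-tuple E) : bool :=
  [forall i : 'I_m, forall j : 'I_m,
     (nat_of_ord j == (nat_of_ord i).+1) ==>
     (if odd i then (nat_of_ord (tnth t i) < nat_of_ord (tnth t j))%N
      else (nat_of_ord (tnth t j) < nat_of_ord (tnth t i))%N)].

Definition num_alt_Bperm (S : {set E}) (B : {set {set E}}) : nat :=
  #|[set t : (#|S|).-tuple E | Bperm S B t && alternating t]|.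

End Building.

Section OrderComplex.
Variable U : finType.
Local Open Scope ring_scope.

(* faces of the order complex Delta(P) with m vertices (nonempty chains of P
   of cardinality m); m = 0 gives the empty face, used for the augmented
   chain complex computing reduced homology *)
Definition ocfaces (P : {set {set U}}) (m : nat) : {set {set {set U}}} :=
  [set c : {set {set U}} | [&& c \subset P,
     [forall x in c, forall y in c, (x \subset y) || (y \subset x)]
     & #|c| == m]].

(* boundary map from faces with m+1 vertices to faces with m vertices
   (row-vector convention: a chain is a row vector, x *m bd gives its
   boundary).  The vertices of a chain are ordered by inclusion; removing
   the vertex x of c gets the sign (-1)^(position of x in c), the position
   being the number of elements of c strictly below x. *)
Definition bdmx (P : {set {set U}}) (m : nat)
  : 'M[rat]_(#|ocfaces P m.+1|, #|ocfaces P m|) :=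
  \matrix_(i, j)
    let c := enum_val (A := ocfaces P m.+1) i in
    let d := enum_val (A := ocfaces P m) j in
    if d \subset c then
      match [pick x in c :\: d] with
      | Some x => (-1) ^+ #|[set y in c | y \proper x]|
      | None => 0
      end
    else 0.

(* dim_Q of the reduced homology group  H~_q(Delta(P); Q)
   = dim ker(d_q) - dim im(d_{q+1}),  d_q : C_q -> C_{q-1},
   where C_q is spanned by faces with q+1 vertices (C_{-1} = Q, empty face). *)
Definition reduced_betti (P : {set {set U}}) (q : nat) : nat :=
  (\rank (kermx (bdmx P q)) - \rank (bdmx P q.+1))%N.

End OrderComplex.

(* Main.v *)
Require Import Defs.
From mathcomp Require Import all_boot all_order all_algebra.
From mathcomp Require Import zify.
Set Implicit Arguments. Unset Strict Implicit. Unset Printing Implicit Defensive.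
Import GRing.Theory.

(** A top-dimensional cycle is a function on maximal chains
    [0 = A_0 < A_1 < ... < A_k = S] (with [#|A_i| = 2i]) whose sum over every
    class of chains agreeing off one rank vanishes.  Label the step
    [A < A + {a > b}] by [(c, a, b)], where [c] is the maximum of the component
    of [A + {a, b}] that receives [a] and [b]; chordality makes [c] already the
    maximum of the component of [a] in [A + {a}].  Rank [i] is a descent if
    [c_i < c_(i+1)], or [c_i = c_(i+1)] and [b_i < a_(i+1)].  Every interval has
    exactly one descent-free chain, the lexicographically first one (largest
    labels first), which successively fills the components with the largest
    maxima by their two largest missing elements.  As in a shelling, a cycle is
    then determined by its arbitrary values on the chains having descents at all
    ranks.  In such a chain the [c_i] increase weakly, hence [c_i = max A_i], and
    [a_1 b_1 a_2 b_2 ...] is exactly an alternating B-permutation. *)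

(** * Linear algebra over an abstract shelling order *)

Section Shelling.
Local Open Scope ring_scope.
Variables (T I V : finType) (M : {set T}).
(** Intended reading: [M] holds the maximal chains, [e X F] is [F] with the ranks in [X] forgotten,
    [R F] is its descent set, and [wt] is smaller on lexicographically earlier chains. *)
Variables (e : {set I} -> T -> V) (R : T -> {set I}) (wt : T -> nat).
Hypothesis e_sub : forall (X Y : {set I}) F G, X \subset Y -> e X F = e X G -> e Y F = e Y G.
Hypothesis R_down : forall F i, F \in M -> i \in R F ->
  exists2 G, G \in M & e [set i] G = e [set i] F /\ (wt G < wt F)%N.
Hypothesis R_first : forall F G X, F \in M -> G \in M -> G != F ->
  e X G = e X F -> [disjoint X & R F] -> (wt F < wt G)%N.

Definition class_sum (f : T -> rat) i F : rat :=
  \sum_(G in M | e [set i] G == e [set i] F) f G.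

Definition falling := [set F in M | R F == setT].

Lemma class_sumD1 f i F : F \in M ->
  class_sum f i F = f F + \sum_(G in M | (e [set i] G == e [set i] F) && (G != F)) f G.
Proof.
move=> FM; rewrite /class_sum (bigD1 F) ?FM ?eqxx //=; congr (_ + _).
by apply: eq_bigl => G; rewrite andbA.
Qed.

Lemma notR_disjoint i j F : i \notin R F -> j \notin R F -> [disjoint [set i; j] & R F].
Proof.
move=> iF jF; apply/pred0P => x /=; rewrite !inE.
by apply/negP => /andP[/orP[]/eqP-> xR]; [rewrite xR in iF|rewrite xR in jF].
Qed.

Lemma notR_first i F G : F \in M -> G \in M -> i \notin R F ->
  e [set i] G = e [set i] F -> G != F -> (wt F < wt G)%N.
Proof.
move=> FM GM iF eGF GF; apply: (R_first FM GM GF eGF).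
by have := notR_disjoint iF iF; rewrite setUid.
Qed.

(** While [i] is a descent, [R_down] passes to a lighter member of the same class; this must
    stop. *)
Lemma class_min F i : F \in M -> exists2 G, G \in M & e [set i] G = e [set i] F /\ i \notin R G.
Proof.
move: {2}(wt F) (leqnn (wt F)) => n; elim: n F => [|n IH] F leF FM.
  exists F => //; split=> //; apply/negP => /(R_down FM)[G _ []]; lia.
case: (boolP (i \in R F)) => [iR|]; last by exists F.
have [G GM [eG ltG]] := R_down FM iR.
have [|H HM [eH HR]] := IH G _ GM; first lia.
by exists H => //; rewrite eH eG.
Qed.

(* Both sums equal the sum over all of the two-rank class minus [F], since the
   remaining one-rank classes sum to zero. *)
Lemma class_sum_indep f F i j : F \in M -> i \notin R F -> j \notin R F ->
  (forall G l, G \in M -> (wt F < wt G)%N -> l \notin R G -> class_sum f l G = 0) ->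
  \sum_(G in M | (e [set i] G == e [set i] F) && (G != F)) f G =
  \sum_(G in M | (e [set j] G == e [set j] F) && (G != F)) f G.
Proof.
move=> FM iF jF f0.
suff main l : l \in [set i; j] ->
  \sum_(G in M | (e [set i; j] G == e [set i; j] F) && (G != F)) f G =
  \sum_(G in M | (e [set l] G == e [set l] F) && (G != F)) f G.
  by rewrite -!main // !inE eqxx ?orbT.
move=> lij.
have sub : [set l] \subset [set i; j] by rewrite sub1set.
rewrite (bigID (fun G => e [set l] G == e [set l] F)) /=.
rewrite [X in _ + X](_ : _ = 0) ?addr0.
  apply: eq_bigl => G; rewrite -!andbA; congr (_ && _).
  by case: (e [set l] G =P _) => [/(e_sub sub)->|]; rewrite ?eqxx ?andbT ?andbF.
rewrite (partition_big (e [set l]) predT) //= big1 // => v _.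
set P := (P in \sum_(G | P G) _).
case: (pickP P) => [G0|P0]; last by rewrite big_pred0.
rewrite /P => /andP[/andP[/andP[G0M /andP[/eqP eG0 G0F]] lG0] /eqP lv].
(* This class for [l] avoids [F] and has a member [H] with [l \notin R H]; [R_first] makes [H]
   heavier than [F], so [f0] applies to it. *)
have [H HM [lH lR]] := class_min l G0M.
have eH : e [set i; j] H = e [set i; j] F by rewrite -eG0; exact: e_sub sub lH.
have HF : H != F by apply: contraNneq lG0 => <-; rewrite lH.
transitivity (class_sum f l H); last first.
  exact: f0 (R_first FM HM HF eH (notR_disjoint iF jF)) lR.
rewrite /class_sum lH; apply: eq_bigl => G; rewrite /P lv -!andbA; congr (_ && _).
case: (e [set l] G =P v) => [lG|_]; rewrite ?andbF // !andbT.
have -> : e [set i; j] G = e [set i; j] F.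
  by rewrite -eG0; apply: e_sub sub _; rewrite lG lv.
rewrite lG -lv lG0 eqxx andbT; apply: contraNneq lG0 => <-.
by rewrite lG lv.
Qed.

(** Values are fixed from the heaviest elements down. If [i \notin R F], the other members of the
    class of [F] at [i] are heavier, so [f F] can be chosen to cancel them; [class_sum_indep] makes
    the choice of [i] immaterial. *)
Lemma fill_classes (g : T -> rat) : exists f : T -> rat,
  (forall F, F \in falling -> f F = g F) /\
  (forall F i, F \in M -> class_sum f i F = 0).
Proof.
pose W := (\max_(F in M) wt F)%N.
have leW F : F \in M -> (wt F <= W)%N by move=> FM; exact: (@leq_bigmax_cond _ (mem M)).
suff main n : exists f : T -> rat, (forall F, F \in falling -> f F = g F) /\
    forall F i, F \in M -> (W < wt F + n)%N -> i \notin R F -> class_sum f i F = 0.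
  (* Every class is reached through a representative without descent at [i]. *)
  have [f [fg f0]] := main W.+1; exists f; split=> // F i FM.
  have [G GM [eG iR]] := class_min i FM.
  by rewrite /class_sum -eG; apply: f0 => //; lia.
elim: n => [|n [f [fg f0]]].
  by exists g; split=> // F i /leW; lia.
(* Only weight exactly [W - n] is revised, so the sums already made zero, which involve heavier
   elements only, are untouched. *)
pose f' F := if [&& F \in M, (wt F + n)%N == W & R F != setT] then
  if [pick i | i \notin R F] is Some i then
   - \sum_(G in M | (e [set i] G == e [set i] F) && (G != F)) f G else f F else f F.
have f'f G : (W < wt G + n)%N -> f' G = f G.
  by rewrite /f' => /gtn_eqF->; rewrite andbF.
exists f'; split=> [F FF|F i FM].
  by rewrite -fg // /f'; move: FF; rewrite inE => /andP[_ ->]; rewrite !andbF.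
rewrite addnS ltnS leq_eqVlt => /orP[/eqP eW|ltW] iR.
  rewrite class_sumD1 //.
  rewrite [in X in _ + X](eq_bigr f); last first.
    move=> G /andP[GM /andP[/eqP eG GF]]; apply: f'f.
    by have := notR_first FM GM iR eG GF; lia.
  rewrite {1}/f' FM -eW eqxx /=.
  have -> : R F != setT by apply: contraNneq iR => ->; rewrite inE.
  case: pickP => [j jR|/(_ i)]; last by rewrite iR.
  rewrite (class_sum_indep FM iR jR) ?addNr // => G l GM FG; apply: f0 => //; lia.
rewrite -[RHS](f0 F i) //; apply: eq_bigr => G /andP[GM /eqP eG]; apply: f'f.
have [->//|GF] := eqVneq G F.
by have := notR_first FM GM iR eG GF; lia.
Qed.

(** An element with a rank outside [R F] is strictly lightest in its class, so once all heavier
    values vanish, its own does too. *)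
Lemma class_sum_eq0 (f : T -> rat) :
  (forall F, F \in falling -> f F = 0) ->
  (forall F i, F \in M -> class_sum f i F = 0) -> forall F, F \in M -> f F = 0.
Proof.
move=> f0 fs.
pose W := (\max_(F in M) wt F)%N.
have leW F : F \in M -> (wt F <= W)%N by move=> FM; exact: (@leq_bigmax_cond _ (mem M)).
suff main n F : F \in M -> (W < wt F + n)%N -> f F = 0.
  by move=> F FM; apply: (main W.+1) => //; lia.
elim: n F => [|n IH] F FM; first by have := leW F FM; lia.
move=> ltW; have [RT|] := eqVneq (R F) setT; first by apply: f0; rewrite inE FM RT eqxx.
rewrite eqEsubset subsetT /= => /subsetPn[i _ iR].
have := fs F i FM; rewrite class_sumD1 // big1 ?addr0 // => G /andP[GM /andP[/eqP eG GF]].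
by apply: IH => //; have := notR_first FM GM iR eG GF; lia.
Qed.

(** Restriction to [falling], encoded by [Q], is injective on the kernel by [class_sum_eq0] and
    surjective by [fill_classes]. *)
Lemma rank_class_kernel p (D : 'M[rat]_(#|M|, p)) :
  (forall f : T -> rat, (\row_j f (enum_val (A := M) j)) *m D = 0 <->
     forall F i, F \in M -> class_sum f i F = 0) ->
  \rank (kermx D) = #|falling|.
Proof.
move=> DP.
pose v (f : T -> rat) : 'rV_#|M| := \row_j f (enum_val j).
have vE (u : 'rV[rat]_#|M|) : exists f, u = v f.
  case: (pickP (mem M)) => [F0 F0M|M0].
    exists (fun F => u 0 (enum_rank_in F0M F)).
    by apply/rowP => j; rewrite mxE enum_valK_in.
  exists (fun=> 0); apply/rowP => j; have := ltn_ord j.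
  by rewrite {2}(eq_card0 M0).
have fM j : enum_val (A := falling) j \in M.
  by have := enum_valP j; rewrite inE => /andP[].
pose Q : 'M[rat]_(#|M|, #|falling|) := \matrix_(i, j) (enum_val i == enum_val j)%:R.
have vQ f : v f *m Q = \row_j f (enum_val (A := falling) j).
  apply/rowP => j; rewrite !mxE.
  rewrite (bigD1 (enum_rank_in (fM j) (enum_val j))) //= big1 ?addr0.
    by rewrite !mxE enum_rankK_in // eqxx mulr1.
  move=> i; rewrite -(inj_eq enum_val_inj) enum_rankK_in // !mxE => /negPf->.
  by rewrite mulr0.
have := mxrank_mul_ker (kermx D) Q.
have -> : (kermx D :&: kermx Q)%MS = 0.
  apply/eqP; rewrite -submx0; apply/rV_subP => u; rewrite sub_capmx.
  have [f ->] := vE u.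
  move=> /andP[/sub_kermxP /DP fD /sub_kermxP fQ].
  rewrite (_ : v f = 0) ?sub0mx //; apply/rowP => j; rewrite !mxE.
  apply: class_sum_eq0 (enum_valP j) => // F FF.
  move: fQ; rewrite vQ => /rowP/(_ (enum_rank_in FF F)).
  by rewrite !mxE enum_rankK_in.
(* What remains is that [kermx D *m Q] is row full: every basis vector is the restriction of a
   cycle. *)
rewrite mxrank0 addn0 => <-; apply/eqP; rewrite -/(row_full _) -sub1mx.
apply/row_subP => j.
have [f [fg fs]] := fill_classes (fun F => (F == enum_val j)%:R).
have -> : row j 1%:M = v f *m Q.
  apply/rowP => i; rewrite vQ !mxE fg ?enum_valP //.
  by rewrite (inj_eq enum_val_inj) eq_sym.
by apply: submxMr; apply/sub_kermxP/DP.
Qed.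

End Shelling.

Lemma radix_lt n q r q' r' : r < n -> q < q' -> q * n + r < q' * n + r'.
Proof.
move=> rn qq; apply: (@leq_trans (q.+1 * n)); first by rewrite mulSn addnC ltn_add2r.
by apply: leq_trans (leq_addr _ _); rewrite leq_mul2r qq orbT.
Qed.

(** * Connected components and the poset of even sets *)

Section BuildingSets.
Variables (N : nat) (S : {set 'I_N}) (B : {set {set 'I_N}}).
Hypotheses (BS : building_set S B) (CH : chordal B).
Implicit Types (I J A C D K X : {set 'I_N}) (x y z a b c m : 'I_N).

(** For [x] in [I] and [I] inside [S], this union is the component of [restr B I] through [x]; for
    [x] outside [I] it is empty. *)
Definition conn I x : {set 'I_N} := \bigcup_(J in B | (J \subset I) && (x \in J)) J.

Lemma conn_sub I x : conn I x \subset I.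
Proof. by apply/bigcupsP => J /and3P[]. Qed.

Lemma conn_max I J x : J \in B -> J \subset I -> x \in J -> J \subset conn I x.
Proof. by move=> JB JI xJ; apply: (bigcup_sup J); rewrite JB JI xJ. Qed.

Lemma conn_self I x : I \subset S -> x \in I -> x \in conn I x.
Proof.
move=> IS xI; have [_ B1 _] := BS.
have := @conn_max I [set x] x; rewrite !sub1set B1 ?(subsetP IS) // => -> //.
by rewrite inE.
Qed.

Lemma conn_in I x : I \subset S -> x \in I -> conn I x \in B.
Proof.
move=> IS xI; have [_ B1 BU] := BS.
have xB : [set x] \in B by rewrite B1 ?(subsetP IS).
(* Starting the union from [[set x]] keeps every partial union in [B] and containing [x], so that
   [BU] applies. *)
have -> : conn I x = \big[@setU _/[set x]]_(J in B | (J \subset I) && (x \in J)) J.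
  have sx : [set x] \subset conn I x by rewrite sub1set conn_self.
  apply/eqP; rewrite eqEsubset; apply/andP; split.
    apply/bigcupsP => J PJ; rewrite (bigD1 J) //=; exact: subsetUl.
  by elim/big_rec: _ => // J X PJ sX; rewrite subUset sX conn_max //; case/and3P: PJ.
suff /andP[] : (\big[@setU _/[set x]]_(J in B | (J \subset I) && (x \in J)) J \in B) &&
   (x \in \big[@setU _/[set x]]_(J in B | (J \subset I) && (x \in J)) J) by [].
elim/big_rec: _ => [|J X /and3P[JB _ xJ] /andP[XB xX]]; first by rewrite xB inE eqxx.
rewrite inE xJ BU //; apply/set0Pn; exists x; by rewrite inE xJ.
Qed.

Lemma conn_eq I x y : I \subset S -> x \in I -> y \in conn I x -> conn I y = conn I x.
Proof.
move=> IS xI yx; have [_ _ BU] := BS.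
have yI := subsetP (conn_sub I x) _ yx.
have s1 : conn I x \subset conn I y by rewrite conn_max ?conn_sub ?conn_in.
apply/eqP; rewrite eqEsubset s1 andbT conn_max ?conn_sub ?conn_in //.
by rewrite (subsetP s1) ?conn_self.
Qed.

Lemma connS I J x : I \subset J -> conn I x \subset conn J x.
Proof.
move=> IJ; apply/bigcupsP => K /and3P[KB KI xK].
by rewrite conn_max // (subset_trans KI).
Qed.

Lemma conn_mem_eq I J x y : I \subset J -> J \subset S -> x \in I -> y \in conn I x ->
  conn J y = conn J x.
Proof.
move=> IJ JS xI yx; apply: conn_eq => //; first exact: (subsetP IJ).
exact: (subsetP (connS x IJ)).
Qed.

Lemma componentsP I C : I \subset S ->
  reflect (exists2 x, x \in I & C = conn I x) (C \in components (restr B I)).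
Proof.
move=> IS; apply: (iffP idP).
  rewrite !inE => /andP[/andP[CB CI] /forall_inP mC].
  have [/(_ C CB)/andP[/set0Pn[x xC] _] _ _] := BS.
  have xI := subsetP CI x xC.
  exists x => //; apply/eqP; rewrite eq_sym.
  have := mC (conn I x); rewrite inE conn_in // conn_sub => /(_ isT)/implyP; apply.
  exact: conn_max.
case=> x xI ->; rewrite !inE conn_in // conn_sub /=.
apply/forall_inP => K; rewrite inE => /andP[KB KI]; apply/implyP => sK.
by rewrite eqEsubset sK andbT conn_max // (subsetP sK) ?conn_self.
Qed.

Lemma PhatP I : reflect (I \subset S /\ forall x, x \in I -> ~~ odd #|conn I x|)
  (I \in Phat S B).
Proof.
rewrite inE; apply: (iffP andP) => -[IS H]; split=> //.
  by move=> x xI; apply: (forall_inP H); apply/componentsP => //; exists x.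
by apply/forall_inP => C /componentsP[] // x xI ->; exact: H.
Qed.

(** [X] is a disjoint union of components of [I], each of even size, and they are removed one at a
    time. *)
Lemma even_closed I X : I \in Phat S B -> X \subset I ->
  (forall x, x \in X -> conn I x \subset X) -> ~~ odd #|X|.
Proof.
move=> /PhatP[IS Iev].
move: {2}#|X| (leqnn #|X|) => n; elim: n X => [|n IH] X.
  by rewrite leqn0 => /eqP->.
move=> Xn XI clX; have [->|/set0Pn[x xX]] := eqVneq X set0; first by rewrite cards0.
have xI := subsetP XI x xX.
have xx := conn_self IS xI.
rewrite -(cardsID (conn I x) X) (setIidPr (clX x xX)) oddD (negPf (Iev x xI)) /=.
apply: IH => [||y /setDP[yX yx]].
- have := cardsID (conn I x) X; rewrite (setIidPr (clX x xX)).
  have : 0 < #|conn I x| by apply/card_gt0P; exists x.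
  lia.
- exact: subset_trans (subsetDl _ _) XI.
have yI := subsetP XI y yX.
apply/subsetP => z zy; rewrite inE (subsetP (clX y yX)) // andbT.
apply: contra yx => zx.
by rewrite -(conn_eq IS xI zx) (conn_eq IS yI zy) conn_self.
Qed.

Lemma Phat_even I : I \in Phat S B -> ~~ odd #|I|.
Proof. by move=> IP; apply: even_closed (IP) _ _ => // x _; exact: conn_sub. Qed.

Lemma PhatS I : I \in Phat S B -> I \subset S.
Proof. by case/PhatP. Qed.

(** * Suffixes from chordality, and labelled two-element steps *)

Lemma suffix_in K x : K \in B -> x \in K -> [set y in K | (x <= y)%N] \in B.
Proof.
move=> KB xK; have [B0 B1 _] := BS.
(* [chordal] speaks of interior [x] only: for the minimum the suffix is [K] itself, for the maximum
   a singleton. *)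
case: (pickP [pred y in K | (y < x)%N]) => [y1 /andP[y1K y1x]|noy]; last first.
  rewrite (_ : [set y in K | _] = K) //; apply/setP => y; rewrite inE.
  by have := noy y; rewrite /=; case: (y \in K) => //=; rewrite ltnNge => /negbFE.
case: (pickP [pred y in K | (x < y)%N]) => [y2 /andP[y2K y2x]|noy]; last first.
  rewrite (_ : [set y in K | _] = [set x]) ?B1 //.
    by have /andP[_ /subsetP/(_ _ xK)] := B0 _ KB.
  apply/setP => y; rewrite !inE.
  have [->|yx] := eqVneq y x; first by rewrite xK leqnn.
  have := noy y; rewrite /=; case: (y \in K) => //= /negbT; rewrite -leqNgt => le.
  apply/negbTE; rewrite -ltnNge ltn_neqAle le andbT; exact: yx.
by apply: CH => //; [exists y1|exists y2].
Qed.

(* [A' = A + {a > b}] and [c] is the maximum of the component of [A'] that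
   receives [a] and [b]. *)
Definition edge A A' c a b : Prop :=
  [/\ A \in Phat S B, A' \in Phat S B,
      [/\ A' = [set a; b] :|: A, a \notin A, b \notin A & (b < a)%N],
      b \in conn A' a &
      c \in conn A' a /\ forall y, y \in conn A' a -> (y <= c)%N].

Lemma max_ex X x : x \in X -> exists2 y, y \in X & forall z, z \in X -> (z <= y)%N.
Proof.
move=> xX; case: (@arg_maxnP _ x (mem X) (@nat_of_ord N) xX) => y yX ym.
by exists y.
Qed.

(** Otherwise the component of [a] in the larger set, with [a] removed, is a union of components of
    [A], hence even, and restoring [a] makes it odd. *)
Lemma conn_two A a b : A \in Phat S B -> [set a; b] :|: A \in Phat S B ->
  a \notin A -> b \in conn ([set a; b] :|: A) a.
Proof.
set A' := _ :|: A => AP A'P aA.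
have [A'S A'ev] := PhatP _ A'P.
have aA' : a \in A' by rewrite !inE eqxx.
apply: contraT => bD; have := A'ev a aA'.
rewrite (cardsD1 a) conn_self //= negbK; set D' := _ :\ a.
have : ~~ odd #|D'|.
  apply: (even_closed AP) => [|x].
    apply/subsetP => x; rewrite !inE => /andP[xa xD].
    have := subsetP (conn_sub A' a) x xD; rewrite !inE (negPf xa) /=.
    by case/orP => // /eqP xb; rewrite -xb xD in bD.
  rewrite !inE => /andP[xa xD]; apply/subsetP => y yx; rewrite !inE.
  apply/andP; split; first by apply: contraNneq aA => <-; exact: (subsetP (conn_sub A x)).
  rewrite -(conn_eq A'S aA' xD); apply: (subsetP (connS x _)) yx; exact: subsetUr.
by move=> /negPf->.
Qed.

Lemma edge_ex A A' : A \in Phat S B -> A' \in Phat S B -> A \subset A' ->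
  #|A'| = (#|A| + 2)%N -> exists c a b, edge A A' c a b.
Proof.
move=> AP A'P sA cA.
have /cards2P[a [b [ab eD]]] : #|A' :\: A| == 2.
  by rewrite cardsDS // cA addKn.
wlog ba : a b ab eD / (b < a)%N.
  move=> W; case: (ltngtP a b) => [|ba|/val_inj]; first 2 last.
  - by move=> E; rewrite E eqxx in ab.
  - by move=> lt; apply: (W b a) => //; rewrite 1?eq_sym // setUC.
  - exact: (W a b).
have eA' : A' = [set a; b] :|: A.
  by rewrite -eD setUC -[X in X :|: _](setIidPr sA) setID.
have := set21 a b; rewrite -eD => /setDP[aA' aA].
have := set22 a b; rewrite -eD => /setDP[bA' bA].
have [c c1 c2] := max_ex (conn_self (PhatS A'P) aA').
exists c, a, b; split=> //; rewrite eA'; apply: conn_two; rewrite -?eA' //.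
Qed.

(** The labels as total numeric functions of a pair of sets, so that [falls] and [weight] need no
    choice of witnesses; on an [edge], [ltop], [lbot] and [lcmp] return [a], [b] and [c]. *)
Definition ltop A A' : nat := \max_(x in A' :\: A) x.
Definition lbot A A' : nat := \sum_(x in A' :\: A) x - ltop A A'.
Definition lcmp A A' : nat := \max_(y in \bigcup_(x in A' :\: A) conn A' x) y.

Section Edge.
Variables (A A' : {set 'I_N}) (c a b : 'I_N).
Hypothesis Ed : edge A A' c a b.

Lemma edge_diff : A' :\: A = [set a; b].
Proof.
case: Ed => _ _ [-> aA bA _] _ _; rewrite setDUl setDv setU0.
apply/setDidPl/pred0P => x /=; rewrite !inE; apply/negP => /andP[/orP[]/eqP->].
  by rewrite (negPf aA).
by rewrite (negPf bA).
Qed.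

Lemma edge_sub : A \subset A'.
Proof. by case: Ed => _ _ [-> _ _ _] _ _; exact: subsetUr. Qed.

Lemma ltopE : ltop A A' = a.
Proof.
case: Ed => _ _ [_ _ _ ba] _ _; rewrite /ltop edge_diff.
apply/eqP; rewrite eqn_leq; apply/andP; split.
  by apply/bigmax_leqP => x; rewrite !inE => /orP[]/eqP-> //; exact: ltnW.
by apply: (@leq_bigmax_cond _ (mem [set a; b])); rewrite inE set21.
Qed.

Lemma lbotE : lbot A A' = b.
Proof.
rewrite /lbot ltopE edge_diff; case: Ed => _ _ [_ _ _ ba] _ _.
rewrite big_setU1 /= ?big_set1 ?addKn // inE; apply: contraTneq ba => ->.
by rewrite ltnn.
Qed.

Lemma lcmpE : lcmp A A' = c.
Proof.
case: Ed => _ A'P [eA' _ _ ba] bD [cD cm]; rewrite /lcmp edge_diff.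
have aA' : a \in A' by rewrite eA' !inE eqxx.
rewrite (_ : \bigcup_(x in _) _ = conn A' a).
  apply/eqP; rewrite eqn_leq; apply/andP; split; first by apply/bigmax_leqP.
  exact: (@leq_bigmax_cond _ (mem (conn A' a))).
apply/eqP; rewrite eqEsubset (bigcup_sup a) ?set21 // andbT.
apply/bigcupsP => x; rewrite !inE => /orP[]/eqP-> //.
by rewrite (conn_eq (PhatS A'P) aA' bD).
Qed.
End Edge.

Definition falls A A' A'' : bool :=
  (lcmp A A' < lcmp A' A'') || (lcmp A A' == lcmp A' A'') && (lbot A A' < ltop A' A'').

(** The label [(c, a, b)] as a three-digit number in base [N], which orders labels
    lexicographically. *)
Definition weight A A' : nat := (lcmp A A' * N + ltop A A') * N + lbot A A'.

(* [A'] adds to [A] the two largest elements of [K :\: A], where [K] is the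
   component of [C] with largest maximum among those not contained in [A]. *)
Definition first_edge A C c a b : Prop :=
  (forall x y, x \in C :\: A -> y \in conn C x -> (y <= c)%N) /\
  (forall x, x \in C :\: A -> x \in conn C a -> x = a \/ (x <= b)%N).

(** A competing label [(c2, a2, b2)] has [c2 <= c]. On equality [a2] and [b2] lie in the component
    of [a] in [C], so [a2 <= a], and if [a2 = a] then [b2 <= b]; full equality would give
    [A'' = A']. *)
Lemma first_edge_weight A A' A'' C c a b : edge A A' c a b -> A' \subset C ->
  C \in Phat S B -> first_edge A C c a b ->
  A'' \in Phat S B -> A \subset A'' -> A'' \subset C -> #|A''| = (#|A| + 2)%N ->
  A'' != A' -> (weight A A'' < weight A A')%N.
Proof.
move=> Ed A'C CP [cm abm] A''P AA'' A''C cA'' nA.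
have [AP A'P [eA' aA bA ba] bD [cD _]] := Ed.
have [c2 [a2 [b2 Ed2]]] := edge_ex AP A''P AA'' cA''.
have [_ _ [eA'' a2A b2A ba2] bD2 [cD2 _]] := Ed2.
have CS := PhatS CP.
have a2A'' : a2 \in A'' by rewrite eA'' !inE eqxx.
have aA' : a \in A' by rewrite eA' !inE eqxx.
have a2C : a2 \in C :\: A by rewrite inE a2A (subsetP A''C).
have b2C : b2 \in C :\: A by rewrite inE b2A (subsetP A''C) // eA'' !inE eqxx orbT.
have lec : (c2 <= c)%N by apply: (cm a2) => //; apply: (subsetP (connS a2 A''C)).
rewrite /weight !(lcmpE Ed, ltopE Ed, lbotE Ed, lcmpE Ed2, ltopE Ed2, lbotE Ed2).
have [ecc|ncc] := eqVneq c2 c; last first.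
  by do 2!apply: radix_lt => //; rewrite ltn_neqAle lec andbT.
(* The shared element [c] puts [a] and [a2] in one component of [C]. *)
have eK : conn C a2 = conn C a.
  rewrite -(conn_mem_eq A'C CS aA' cD) -ecc.
  by rewrite (conn_mem_eq A''C CS a2A'' cD2).
have a2K : a2 \in conn C a by rewrite -eK conn_self // (subsetP A''C).
have b2K : b2 \in conn C a by rewrite -eK (subsetP (connS a2 A''C)).
rewrite ecc.
have [ea|na] := eqVneq a2 a; last first.
  apply: radix_lt => //; rewrite ltn_add2l.
  by case: (abm a2 a2C a2K) na => [->|le _]; rewrite ?eqxx // (leq_ltn_trans le).
rewrite ea ltn_add2l; case: (abm b2 b2C b2K) => [eb|b2b].
  by move: ba2; rewrite ea eb ltnn.
rewrite ltn_neqAle b2b andbT; apply: contraNneq nA => /val_inj eb.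
by rewrite eA' eA'' ea eb.
Qed.

End BuildingSets.

(** * Descent-free chains and first steps of an interval *)

Section BuildingSets.
Variables (N : nat) (S : {set 'I_N}) (B : {set {set 'I_N}}).
Hypotheses (BS : building_set S B) (CH : chordal B).
Implicit Types (I J A C D K X : {set 'I_N}) (x y z a b c m : 'I_N).
Local Notation conn := (conn B).
Local Notation edge := (edge S B).

(* By chordality the elements of [conn C x] that are at least [x] form a member
   of [B], so they stay connected in any [I] containing them. *)
Lemma suffix_conn I C x y : I \subset C -> C \subset S -> x \in I ->
  (forall z, z \in conn C x -> (x <= z)%N -> z \in I) ->
  y \in conn C x -> (x <= y)%N -> y \in conn I x.
Proof.
move=> IC CS xI sufI yC xy.
have xC : x \in C by exact: (subsetP IC).
have xx := conn_self BS CS xC.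
have KB := suffix_in BS CH (conn_in BS CS xC) xx.
apply: (subsetP (conn_max KB _ _)); rewrite ?inE ?xx ?yC ?leqnn //.
by apply/subsetP => z; rewrite inE => /andP[]; exact: sufI.
Qed.

Definition flag (L : nat -> {set 'I_N}) n : Prop :=
  (forall i, (i <= n)%N -> L i \in Phat S B) /\
  (forall i, (i < n)%N -> L i \subset L i.+1 /\ #|L i.+1| = (#|L i| + 2)%N).

Section Flag.
Variables (L : nat -> {set 'I_N}) (n : nat).
Hypothesis FL : flag L n.

Lemma flag_sub i j : (i <= j <= n)%N -> L i \subset L j.
Proof.
move=> /andP[]; elim: j => [|j IH]; first by rewrite leqn0 => /eqP->.
rewrite leq_eqVlt => /orP[/eqP->//|ij] jn.
by apply: subset_trans (IH ij (ltnW jn)) _; case: FL => _ /(_ j jn)[].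
Qed.

Lemma flag_edge i : (i < n)%N -> exists c a b, edge (L i) (L i.+1) c a b.
Proof.
case: FL => FP FS lt; have [s c] := FS i lt.
by apply: edge_ex => //; apply: FP => //; exact: ltnW.
Qed.

Lemma flag_step x p : (p <= n)%N -> x \in L n :\: L p ->
  exists2 j, (p <= j < n)%N & x \in L j.+1 :\: L j.
Proof.
move=> pn; rewrite inE => /andP[xp].
have : forall r : nat, (r <= n)%N -> x \in L r ->
    exists2 j, (p <= j < n)%N & x \in L j.+1 :\: L j.
  elim=> [|r IH] rn xr.
    by case/negP: xp; apply: (subsetP (flag_sub _)) xr; rewrite leq0n.
  have [xr'|xr'] := boolP (x \in L r); first by apply: IH => //; exact: ltnW.
  exists r; last by rewrite inE xr'.
  rewrite rn andbT leqNgt; apply: contra xp => rp.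
  by apply: (subsetP (flag_sub _)) xr; rewrite rp.
by apply.
Qed.

Hypothesis n0 : (0 < n)%N.
Hypothesis rising : forall i, (i.+1 < n)%N -> ~~ falls B (L i) (L i.+1) (L i.+2).
Variables (c a b : 'I_N).
Hypothesis Ed : edge (L 0) (L 1) c a b.

(** Without descents [c] never increases, and while it stays constant each top is at most the
    preceding bottom; since bottoms lie below tops, the comparison with the first step persists. *)
Lemma rising_labels j : (0 < j < n)%N ->
  (lcmp B (L j) (L j.+1) < c)%N \/
  lcmp B (L j) (L j.+1) = c /\ (ltop (L j) (L j.+1) <= b)%N.
Proof.
elim: j => // j IH /= jn; have := rising jn; rewrite /falls negb_or negb_and -!leqNgt.
case: j IH jn => [_ _|j IH jn].
  rewrite (lcmpE BS Ed) (lbotE Ed) leq_eqVlt => /andP[/orP[/eqP->|]]; last by left.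
  by rewrite eqxx => le; right.
have [c' [a' [b' Ed']]] := flag_edge (ltnW jn).
have := IH (ltnW jn); rewrite (lcmpE BS Ed') (lbotE Ed') (ltopE Ed').
have [_ _ [_ _ _ ba'] _ _] := Ed'.
move: (lcmp _ _ _) (ltop _ _) ba' => m1 m2; clear.
move=> ba [lt|[-> ab]] /andP[]; first by left; lia.
rewrite leq_eqVlt => /orP[/eqP->|]; last by left.
by rewrite eqxx /= => h; right; split=> //; lia.
Qed.

(** The largest new element of a component of [L n] is the top of the step adding it, and by
    chordality the label of that step bounds the whole component; [rising_labels] compares this
    label with the first one. *)
Lemma rising_first_edge : first_edge B (L 0) (L n) c a b.
Proof.
have [AP A'P [eA' aA bA ba] bD [cD cm]] := Ed.
have FP i : (i <= n)%N -> L i \in Phat S B by case: FL => + _; apply.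
have LS i : (i <= n)%N -> L i \subset S by move=> ?; apply: (PhatS BS) (FP _ _).
have aL1 : a \in L 1 by rewrite eA' !inE eqxx.
(* The case [p = 0] yields the bound by [c]; [p = 1], in the component of [a], yields the bound by
   [b]. *)
have new_top p x : (p < n)%N -> x \in L n :\: L p ->
    (forall y, y \in conn (L n) x -> y \notin L p -> (y <= x)%N) ->
    exists j c' b', [/\ (p <= j < n)%N, edge (L j) (L j.+1) c' x b' &
      forall y, y \in conn (L n) x -> (y <= c')%N].
  move=> pn xD xm; have [j /andP[pj jn] xj] := flag_step (ltnW pn) xD.
  have [c' [a' [b' Ed']]] := flag_edge jn.
  have [_ _ [e1 a'j b'j b'a'] b'D [c'D c'm]] := Ed'.
  have sj : L j.+1 \subset L n by apply: flag_sub; rewrite jn leqnn.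
  have a'1 : a' \in L j.+1 by rewrite e1 !inE eqxx.
  (* If [x] were the bottom of its step, the top would be a larger element of the same component
     outside [L p]. *)
  have xa' : x = a'.
    move: xj; rewrite (edge_diff Ed') !inE => /orP[/eqP//|/eqP xb'].
    have : (a' <= x)%N.
      apply: xm.
        have -> : conn (L n) x = conn (L n) a'.
          by apply: (conn_mem_eq BS sj (LS _ (leqnn n)) a'1); rewrite xb'.
        by apply: (conn_self BS); [exact: LS|exact: (subsetP sj)].
      by apply: contra a'j; apply: subsetP; apply: flag_sub; rewrite pj ltnW.
    by rewrite xb' leqNgt b'a'.
  exists j, c', b'; split; rewrite ?pj ?xa' // => y yx.
  have [le|lt] := leqP a' y.
    apply: c'm; apply: (suffix_conn sj (LS _ (leqnn n))) => //.
    (* An element of the component that is at least [a'] lies in [L p] or equals [a'], hence lies in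
       [L j.+1]. *)
    move=> z zx lez; have [zp|zp] := boolP (z \in L p).
      by apply: (subsetP (flag_sub _)) zp; rewrite jn andbT leqW.
    have zle := xm z; rewrite xa' in zle.
    suff -> : z = a' by [].
    by apply/val_inj/eqP; rewrite eqn_leq lez zle.
  apply: (leq_trans (ltnW lt)); apply: c'm; apply: (conn_self BS) => //; exact: LS.
split=> [x y xD yx|x xD xa].
  have xn : x \in L n by case/setDP: xD.
  have xx := conn_self BS (LS _ (leqnn n)) xn.
  have xX : x \in conn (L n) x :\: L 0 by rewrite inE xx; case/setDP: xD => _ ->.
  have [x0 /setDP[x0x x0L] x0m] := max_ex xX.
  have ex0 := conn_eq BS (LS _ (leqnn n)) xn x0x.
  have x0D : x0 \in L n :\: L 0 by rewrite inE x0L (subsetP (conn_sub _ _ _) _ x0x).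
  have [|j [c' [b' [/andP[_ jn] Ed' H]]]] := new_top 0%N x0 n0 x0D.
    by move=> z; rewrite ex0 => zx z0; apply: x0m; rewrite inE z0.
  apply: (leq_trans (H y _)); first by rewrite ex0.
  case: j jn Ed' => [|j] jn Ed'.
    by rewrite -(lcmpE BS Ed') (lcmpE BS Ed).
  have := @rising_labels j.+1 jn; rewrite (lcmpE BS Ed') => -[/ltnW//|[-> _]]; exact: leqnn.
have [->|nxa] := eqVneq x a; [by left|right].
have [->//|nxb] := eqVneq x b.
have xn : x \in L n by case/setDP: xD.
have s1 : L 1 \subset L n by apply: flag_sub; rewrite n0 leqnn.
have an : a \in L n by exact: (subsetP s1).
have x1 : x \notin L 1.
  by case/setDP: xD => _ x0; rewrite eA' !inE !negb_or nxa nxb.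
have n1 : (1 < n)%N.
  by rewrite ltn_neqAle n0 andbT; apply: contraNneq x1 => ->.
have xX : x \in conn (L n) a :\: L 1 by rewrite inE xa x1.
have [x0 /setDP[x0x x0L] x0m] := max_ex xX.
apply: (leq_trans (x0m x xX)).
have ex0 := conn_eq BS (LS _ (leqnn n)) an x0x.
have x0D : x0 \in L n :\: L 1 by rewrite inE x0L (subsetP (conn_sub _ _ _) _ x0x).
have [|j [c' [b' [/andP[j0 jn] Ed' H]]]] := new_top 1%N x0 n1 x0D.
  by move=> z; rewrite ex0 => zx z0; apply: x0m; rewrite inE z0.
(* The component contains [c], so the label at [x0] is not below [c], and [rising_labels] leaves
   only [x0 <= b]. *)
have : (c <= c')%N.
  by apply: H; rewrite ex0; apply: (subsetP (connS _ a s1)).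
have := @rising_labels j; rewrite j0 jn (lcmpE BS Ed') (ltopE Ed') => /(_ isT).
by case=> [lt|[]//]; rewrite leqNgt lt.
Qed.
End Flag.

(** Parity supplies two elements to add, and chordality joins them to [c] inside [A']. *)
Lemma first_edge_ex A C : A \in Phat S B -> C \in Phat S B -> A \proper C ->
  exists A' c a b, [/\ edge A A' c a b, A' \subset C & first_edge B A C c a b].
Proof.
move=> AP CP /properP[AC [x0 x0C x0A]].
have CS := PhatS BS CP; have AS := PhatS BS AP.
pose U := \bigcup_(x in C :\: A) conn C x.
have x0D : x0 \in C :\: A by rewrite inE x0A.
have [c /bigcupP[x1 x1D cx1] cm] : exists2 c, c \in U & forall z, z \in U -> (z <= c)%N.
  by apply: (@max_ex _ _ x0); apply/bigcupP; exists x0 => //; apply: (conn_self BS).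
have [x1C x1A] := setDP x1D.
pose K := conn C x1.
have x1K : x1 \in K :\: A by rewrite inE x1A (conn_self BS).
have [a /setDP[aK aA] am] := max_ex x1K.
have eK x : x \in K -> conn C x = K by move=> xK; apply: (conn_eq BS).
(* [K :&: A] is a union of components of [A], hence even. So [K :\: A], which contains [a], has a
   second element. *)
have Kev : ~~ odd #|K :\: A|.
  have [_ Cev] := PhatP BS _ CP.
  have /(congr1 odd) := cardsID A K.
  rewrite oddD (negPf (Cev x1 x1C)).
  suff /negPf-> : ~~ odd #|K :&: A| by move=> /= ->.
  apply: (even_closed BS AP); first exact: subsetIr.
  move=> x /setIP[xK xA]; rewrite subsetI conn_sub andbT -(eK x xK).
  exact: connS.
have [b /setD1P[ba bKA] bm] : exists2 b, b \in (K :\: A) :\ a &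
    forall z, z \in (K :\: A) :\ a -> (z <= b)%N.
  have /set0Pn[x xX] : (K :\: A) :\ a != set0.
    apply: contraNneq Kev => e0; rewrite (cardsD1 a) in_setD aA aK e0 cards0 //.
  exact: max_ex xX.
have [bK bA] := setDP bKA.
have ltba : (b < a)%N.
  by rewrite ltn_neqAle am // andbT.
pose A' := [set a; b] :|: A.
have A'C : A' \subset C.
  rewrite subUset AC andbT; apply/subsetP => x; rewrite !inE.
  by case/orP => /eqP->; apply: (subsetP (conn_sub B C x1)).
have A'S := subset_trans A'C CS.
have aA' : a \in A' by rewrite !inE eqxx.
have bA' : b \in A' by rewrite !inE eqxx orbT.
(* Elements of [K] from [b] upward are [a], [b] or in [A], so they all lie in [A']. *)
have suf x : x \in K -> (b <= x)%N -> x \in conn A' b.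
  move=> xK bx; apply: (suffix_conn A'C CS bA') => //; last by rewrite eK.
  move=> z; rewrite eK // => zK bz; rewrite !inE.
  have [//|za] := eqVneq z a; have [//|zA] := boolP (z \in A); rewrite ?orbT //.
  rewrite orbF /=; apply/eqP/val_inj/eqP; rewrite eqn_leq bz andbT.
  by apply: bm; rewrite !inE za zA.
have aDb : a \in conn A' b by apply: suf => //; exact: ltnW.
have eab : conn A' a = conn A' b by apply: (conn_eq BS).
have cK : (a <= c)%N by apply: cm; apply/bigcupP; exists x1.
have cD : c \in conn A' a.
  by rewrite eab; apply: suf => //; apply: leq_trans cK; exact: ltnW.
(* The component of [a], without [a] and [b], is a union of components of [A]; every other component
   of [A'] is one of [A]. *)
have A'P : A' \in Phat S B.
  have [_ Aev] := PhatP BS _ AP.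
  have Dev : ~~ odd #|conn A' a|.
    rewrite (cardsD1 a) (conn_self BS) //= (cardsD1 b) in_setD1 neq_ltn ltba /=.
    rewrite {1}eab (conn_self BS) //= negbK.
    apply: (even_closed BS AP) => [|x].
      apply/subsetP => x; rewrite !in_setD1 => /and3P[xb xa xD].
      by have := subsetP (conn_sub B A' a) x xD; rewrite !inE (negPf xa) (negPf xb).
    rewrite !in_setD1 => /and3P[xb xa xD]; apply/subsetP => y yx; rewrite !in_setD1.
    have yA := subsetP (conn_sub B A x) _ yx.
    have -> : y != b by apply: contraNneq bA => <-.
    have -> : y != a by apply: contraNneq aA => <-.
    rewrite -(conn_eq BS A'S aA' xD); apply: (subsetP (connS B x _)) yx; exact: subsetUr.
  apply/(PhatP BS) => //; split=> // x xA'.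
  have [xD|xD] := boolP (x \in conn A' a); first by rewrite (conn_eq BS A'S aA' xD).
  have xA : x \in A.
    move: xA'; rewrite !inE => /orP[/orP[]/eqP E|//]; case/negP: xD; rewrite E.
      exact: (conn_self BS).
    by rewrite eab (conn_self BS).
  have -> : conn A' x = conn A x; last exact: Aev.
  apply/eqP; rewrite eqEsubset [X in _ && X]connS ?subsetUr // andbT.
  apply: conn_max; rewrite ?(conn_in BS) ?(conn_self BS) //.
  apply/subsetP => y yx; have := subsetP (conn_sub B A' x) _ yx.
  rewrite !inE => /orP[/orP[]/eqP E|//]; case/negP: xD; subst y.
    by rewrite (conn_eq BS A'S xA' yx) (conn_self BS).
  by rewrite eab (conn_eq BS A'S xA' yx) (conn_self BS).
have sD : conn A' a \subset K by rewrite -(eK a aK); apply: connS.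
exists A', c, a, b; split=> //.
  split=> //; first by rewrite eab (conn_self BS).
  split=> // y yD; apply: cm; apply/bigcupP; exists x1 => //; exact: (subsetP sD).
split=> [x y xD yx|x xD]; first by apply: cm; apply/bigcupP; exists x.
rewrite eK // => xK; have [->|xa] := eqVneq x a; [by left|right].
by apply: bm; rewrite in_setD1 xa in_setD xK; case/setDP: xD => _ ->.
Qed.

(** The next label has [c2 <= c]; on equality [a2] lies in the component of [a] in [C] and differs
    from [a], so [a2 <= b]. *)
Lemma first_edge_rising A A' C c a b : edge A A' c a b -> first_edge B A C c a b ->
  A' \subset C -> C \in Phat S B -> #|C| = (#|A'| + 2)%N -> ~~ falls B A A' C.
Proof.
move=> Ed [cm abm] A'C CP cC.
have [AP A'P [eA' aA bA ba] bD [cD _]] := Ed.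
have [c2 [a2 [b2 Ed2]]] := edge_ex BS A'P CP A'C cC.
have [_ _ [eC a2A b2A ba2] bD2 [cD2 _]] := Ed2.
have CS := PhatS BS CP.
have a2C : a2 \in C by rewrite eC !inE eqxx.
have aA' : a \in A' by rewrite eA' !inE eqxx.
have a2D : a2 \in C :\: A.
  by rewrite inE a2C andbT; apply: contra a2A => H; rewrite eA' inE H orbT.
rewrite /falls (lcmpE BS Ed) (lcmpE BS Ed2) (lbotE Ed) (ltopE Ed2).
rewrite negb_or negb_and -!leqNgt (cm a2 c2) //=.
rewrite -implybE; apply/implyP => /eqP/val_inj ecc; subst c2.
have eK : conn C a2 = conn C a.
  by rewrite -(conn_mem_eq BS A'C CS aA' cD) (conn_eq BS CS a2C cD2).
case: (abm a2 a2D) => [|e2|//]; first by rewrite -eK (conn_self BS).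
by case/negP: a2A; rewrite e2.
Qed.

End BuildingSets.

(** * Lexicographic comparison through radix expansions, [u 0] being the leading digit *)

Fixpoint radix (d : nat) (u : nat -> nat) n :=
  if n is m.+1 then radix d u m * d + u m else 0.

Lemma radix_lex d u v n p : (forall j, u j < d) -> p < n ->
  (forall j, j < p -> u j = v j) -> u p < v p -> radix d u n < radix d v n.
Proof.
move=> ud + uv lt; elim: n => // n IH; rewrite ltnS leq_eqVlt => /orP[/eqP e|/IH lt'] /=.
  have : forall m, m <= p -> radix d u m = radix d v m.
    by elim=> //= m IHm mp; rewrite IHm ?uv // ltnW.
  by rewrite -e => -> //; rewrite ltn_add2l.
exact: radix_lt.
Qed.

(** * Maximal chains, as faces with [q.+1] vertices for [k = q.+2] *)

Section Faces.
Variables (N : nat) (S : {set 'I_N}) (B : {set {set 'I_N}}) (q : nat).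
Hypotheses (BS : building_set S B) (CH : chordal B).
Hypotheses (cS : #|S| = (2 * q.+2)%N) (SP : S \in Phat S B).
Implicit Types (I J A C D K X : {set 'I_N}) (x y z a b c m : 'I_N).
Local Notation conn := (conn B).
Local Notation edge := (edge S B).
Local Notation P := (PB S B).
Local Notation M := (ocfaces P q.+1).
Implicit Types (F G : {set {set 'I_N}}).

Lemma set0_Phat : set0 \in Phat S B.
Proof. by apply/(PhatP BS); split=> [|x]; rewrite ?sub0set ?inE. Qed.

Lemma ocfacesP k F : reflect [/\ F \subset P,
  forall X Y, X \in F -> Y \in F -> (X \subset Y) || (Y \subset X) & #|F| = k]
  (F \in ocfaces P k).
Proof.
rewrite inE; apply: (iffP and3P) => -[sP ch cF]; split=> //; try exact/eqP.
  by move=> X Y XF YF; exact: (forall_inP (forall_inP ch X XF) Y YF).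
by apply/forall_inP => X XF; apply/forall_inP => Y YF; exact: ch.
Qed.

Lemma PB_rank X : X \in P -> exists2 i : 'I_q.+1, #|X| = (2 * i.+1)%N & X \subset S.
Proof.
rewrite !inE negb_or => /andP[/andP[X0 XS] XP].
have {}XP : X \in Phat S B by rewrite inE.
have sX := PhatS BS XP.
have : #|X| < #|S| by rewrite proper_card // properEneq XS.
move: X0; rewrite -card_gt0 cS => X0 XlS.
have := odd_double_half #|X|; rewrite (negPf (Phat_even BS XP)) add0n -mul2n => e.
have lt : #|X|./2.-1 < q.+1 by move: #|X| X0 XlS e; clear; lia.
exists (Ordinal lt) => //=; rewrite -{1}e; congr (2 * _)%N.
by move: #|X| X0 e; clear; lia.
Qed.

Lemma ocfaces_card_inj k F X Y : F \in ocfaces P k -> X \in F -> Y \in F ->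
  #|X| = #|Y| -> X = Y.
Proof.
move=> /ocfacesP[_ ch _] XF YF e.
by case/orP: (ch X Y XF YF) => s; apply/eqP; [|rewrite eq_sym]; rewrite eqEcard s e leqnn.
Qed.

(** Ranks are numbered from zero: [i] stands for cardinality [2 * i.+1]. *)
Definition rk X : 'I_q.+1 := inord (#|X|./2.-1).

Lemma rkE X (i : 'I_q.+1) : #|X| = (2 * i.+1)%N -> rk X = i.
Proof. by move=> e; apply: val_inj; rewrite /rk e mul2n doubleK /= inordK. Qed.

Lemma card_rk X : X \in P -> #|X| = (2 * (rk X).+1)%N.
Proof. by move=> /PB_rank[i e _]; rewrite (rkE e). Qed.

Lemma rk_inj k F : F \in ocfaces P k -> {in F &, injective rk}.
Proof.
move=> FM X Y XF YF e; have /ocfacesP[/subsetP sP _ _] := FM.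
by apply: (ocfaces_card_inj FM XF YF); rewrite !card_rk ?sP // e.
Qed.

(** Ranks are distinct along a chain and there are only [q.+1] of them. *)
Lemma ocfaces_top : ocfaces P q.+2 = set0.
Proof.
apply/setP => F; rewrite in_set0; apply/negP => FM; have /ocfacesP[_ _ cF] := FM.
have := card_in_imset (rk_inj FM); rewrite cF => e.
by have := max_card (mem (rk @: F)); rewrite e card_ord ltnn.
Qed.

Lemma lvl_ex F (i : 'I_q.+1) : F \in M -> exists2 X, X \in F & #|X| = (2 * i.+1)%N.
Proof.
move=> FM; have /ocfacesP[/subsetP sP _ cF] := FM.
have e : rk @: F = setT.
  by apply/eqP; rewrite eqEcard subsetT cardsT card_ord (card_in_imset (rk_inj FM)) cF leqnn.
have : i \in rk @: F by rewrite e.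
by case/imsetP => X XF ->; exists X => //; rewrite card_rk ?sP.
Qed.

(** In a chain this union is its largest member of size at most [2 * i]. Adjoining [S] provides the
    top level, and the bottom level is empty. *)
Definition lvl F i : {set 'I_N} := \bigcup_(X in S |: F | #|X| <= 2 * i) X.

Lemma face_sub F X : F \in M -> X \in S |: F -> X \subset S.
Proof.
move=> /ocfacesP[/subsetP sP _ _]; rewrite !inE => /orP[/eqP->//|/sP/PB_rank[]//].
Qed.

Lemma lvlE F X i : F \in M -> X \in F -> #|X| = (2 * i)%N -> lvl F i = X.
Proof.
move=> FM XF cX; have /ocfacesP[/subsetP sP ch _] := FM.
apply/eqP; rewrite eqEsubset; apply/andP; split; last first.
  by apply: (bigcup_sup X); rewrite ?inE ?XF ?orbT ?cX ?leqnn.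
apply/bigcupsP => Y /andP[]; rewrite in_setU1 => /orP[/eqP->|YF].
  have [j cXj _] := PB_rank (sP X XF).
  by rewrite cS cXj in cX *; move=> le; have := ltn_ord j; move: le cX; clear; lia.
case/orP: (ch Y X YF XF) => // XY; rewrite -cX => le.
by rewrite (_ : Y = X) //; apply/eqP; rewrite eq_sym eqEcard XY.
Qed.

Lemma lvl_mem F (i : 'I_q.+1) : F \in M -> lvl F i.+1 \in F.
Proof. by move=> FM; have [X XF e] := lvl_ex i FM; rewrite (lvlE FM XF e). Qed.

Lemma lvl0 F : F \in M -> lvl F 0 = set0.
Proof.
move=> FM; apply/eqP; rewrite -subset0; apply/bigcupsP => X /andP[_].
by rewrite muln0 leqn0 cards_eq0 => /eqP->.
Qed.

Lemma lvlS F : F \in M -> lvl F q.+2 = S.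
Proof.
move=> FM; apply/eqP; rewrite eqEsubset; apply/andP; split.
  by apply/bigcupsP => X /andP[XF _]; exact: face_sub FM XF.
by apply: (bigcup_sup S); rewrite ?cS ?setU11 ?leqnn.
Qed.

Variant lvl_spec F : nat -> Prop :=
  | LvlBot of lvl F 0 = set0 : lvl_spec F 0
  | LvlMid (i : 'I_q.+1) of lvl F i.+1 \in F : lvl_spec F i.+1
  | LvlTop of lvl F q.+2 = S : lvl_spec F q.+2.

Lemma lvlP F i : F \in M -> i <= q.+2 -> lvl_spec F i.
Proof.
move=> FM; case: i => [|i]; first by move=> _; constructor; exact: lvl0.
rewrite ltnS leq_eqVlt => /orP[/eqP->|lt]; first by constructor; exact: lvlS.
by have := @LvlMid F (Ordinal lt) (lvl_mem (Ordinal lt) FM).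
Qed.

Lemma lvl_Phat F i : F \in M -> i <= q.+2 -> lvl F i \in Phat S B.
Proof.
move=> FM le; case: (lvlP FM le) => [->|j jF|->//]; first exact: set0_Phat.
by have /ocfacesP[/subsetP/(_ _ jF) + _ _] := FM; rewrite inE => /andP[].
Qed.

Lemma lvl_card F i : F \in M -> i <= q.+2 -> #|lvl F i| = (2 * i)%N.
Proof.
move=> FM le; case: (lvlP FM le) => [->|j jF|->//]; first by rewrite cards0.
by have [X XF e] := lvl_ex j FM; rewrite (lvlE FM XF e).
Qed.

Lemma lvl_sub F i j : i <= j -> lvl F i \subset lvl F j.
Proof.
move=> ij; apply/bigcupsP => X /andP[XF le]; apply: (bigcup_sup X) => //.
by rewrite XF (leq_trans le) // leq_pmul2l.
Qed.

Lemma lvl_flag F p n : F \in M -> p + n <= q.+2 -> flag S B (fun i => lvl F (p + i)) n.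
Proof.
move=> FM le; split=> i lt.
  by apply: lvl_Phat => //; apply: leq_trans le; rewrite leq_add2l.
have le2 : p + i.+1 <= q.+2 by apply: leq_trans le; rewrite leq_add2l.
split; first by apply: lvl_sub; rewrite leq_add2l.
rewrite lvl_card // lvl_card //; first by rewrite addnS mulnS addnC.
by apply: leq_trans le2; rewrite leq_add2l leqnSn.
Qed.

(** Vertices are removed by cardinality, so [erase] makes sense on any family; two maximal chains
    have the same image when they agree off the ranks in [X]. *)
Definition erase (X : {set 'I_q.+1}) F := [set Y in F | [forall i in X, #|Y| != (2 * i.+1)%N]].

Lemma erase_sub (X Y : {set 'I_q.+1}) F G : X \subset Y -> erase X F = erase X G ->
  erase Y F = erase Y G.
Proof.
move=> XY e.
have eE H : erase Y H = [set Z in erase X H | [forall i in Y, #|Z| != (2 * i.+1)%N]].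
  apply/setP => Z; rewrite !inE -andbA; congr (_ && _).
  apply/idP/andP => [H1|[]//]; split=> //.
  by apply/forall_inP => i iX; apply: (forall_inP H1); exact: (subsetP XY).
by rewrite eE e -eE.
Qed.

Lemma erase_lvl (X : {set 'I_q.+1}) F G (i : 'I_q.+1) : F \in M -> G \in M ->
  erase X F = erase X G -> i \notin X -> lvl F i.+1 = lvl G i.+1.
Proof.
move=> FM GM e iX.
have : lvl F i.+1 \in erase X F.
  rewrite inE lvl_mem //; apply/forall_inP => j jX; rewrite (lvl_card FM (leqW (ltn_ord i))) eqn_pmul2l //.
  by rewrite eqSS; apply: contraNneq iX => /val_inj->.
by rewrite e inE => /andP[iG _]; rewrite (lvlE GM iG (lvl_card FM (leqW (ltn_ord i)))).
Qed.

Lemma lvl_inj F G : F \in M -> G \in M -> (forall i : 'I_q.+1, lvl F i.+1 = lvl G i.+1) -> F = G.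
Proof.
move=> FM GM e.
have /ocfacesP[/subsetP sP _ cF] := FM; have /ocfacesP[_ _ cG] := GM.
apply/eqP; rewrite eqEcard cF cG leqnn andbT; apply/subsetP => X XF.
have [i cX _] := PB_rank (sP X XF).
by rewrite -(lvlE FM XF cX) e lvl_mem.
Qed.

Definition descents F : {set 'I_q.+1} :=
  [set i : 'I_q.+1 | falls B (lvl F i) (lvl F i.+1) (lvl F i.+2)].

(** The digits are complemented step labels, earliest step leading, so lexicographically larger
    label sequences weigh less. *)
Definition face_weight F :=
  radix (N * N * N).+1 (fun i => N * N * N - weight B (lvl F i) (lvl F i.+1)) q.+2.

Lemma edge_weight_lt A A' c a b : edge A A' c a b -> weight B A A' < N * N * N.
Proof.
move=> Ed; rewrite /weight (lcmpE BS Ed) (ltopE Ed) (lbotE Ed).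
by rewrite -[N * N * N]addn0 -[N * N]addn0; do 2!apply: radix_lt => //.
Qed.

Lemma edge_card A A' c a b : edge A A' c a b -> #|A'| = (#|A| + 2)%N.
Proof.
move=> Ed; have [_ _ [_ _ _ ba] _ _] := Ed.
have := cardsDS (edge_sub Ed); rewrite (edge_diff Ed) cards2 neq_ltn ba orbT.
by have := subset_leq_card (edge_sub Ed); lia.
Qed.

Lemma face_weight_lex F G p : F \in M -> G \in M -> p < q.+2 ->
  (forall j, j <= p -> lvl F j = lvl G j) ->
  weight B (lvl G p) (lvl G p.+1) < weight B (lvl F p) (lvl F p.+1) ->
  face_weight F < face_weight G.
Proof.
move=> FM GM pq e lt; apply: (@radix_lex _ _ _ _ p) => // [j|j jp|].
- by rewrite ltnS leq_subr.
- by rewrite !e // ltnW.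
have [|c [a [b Ed]]] := flag_edge BS (@lvl_flag F p 1 FM _) (ltnSn 0); first by rewrite addn1.
have := edge_weight_lt Ed; rewrite addn0 addn1 => h.
by apply: ltn_sub2l => //; exact: ltn_trans h.
Qed.

(** Level [i.+1] is replaced by the first step from level [i] towards level [i.+2]. That step
    creates no descent, so it differs from the old one and has a larger label. *)
Lemma descents_down F (i : 'I_q.+1) : F \in M -> i \in descents F ->
  exists2 G, G \in M & erase [set i] G = erase [set i] F /\ (face_weight G < face_weight F)%N.
Proof.
move=> FM; rewrite inE => fall.
have /ocfacesP[/subsetP sP ch cF] := FM.
have iq : i < q.+1 by [].
have i2 : i <= q.+2 by rewrite ltnW // ltnW.
have AP := lvl_Phat FM i2; have CP := lvl_Phat FM (iq : i.+2 <= q.+2).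
have cA := lvl_card FM i2; have cC := lvl_card FM (iq : i.+2 <= q.+2).
have cA1 := lvl_card FM (ltnW (iq : i.+1 < q.+2)).
have A1F := lvl_mem i FM.
set A := lvl F i in fall AP cA; set A1 := lvl F i.+1 in fall cA1 A1F.
set C := lvl F i.+2 in fall CP cC.
have AA1 : A \subset A1 by apply: lvl_sub.
have A1C : A1 \subset C by apply: lvl_sub.
have AC : A \proper C.
  by rewrite properEcard (subset_trans AA1) // cA cC ltn_pmul2l // ltnS leqnSn.
have [A' [c [a [b [Ed A'C fe]]]]] := first_edge_ex BS CH AP CP AC.
have AA' := edge_sub Ed; have [_ A'P _ _ _] := Ed.
have cA' : #|A'| = (2 * i.+1)%N by rewrite (edge_card Ed) cA mulnS addnC.
have nA1 : A1 != A'.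
  apply: contraTneq fall => ->; apply: (first_edge_rising BS Ed fe) => //.
  by rewrite cC cA' mulnS addnC.
have A'F : A' \notin F.
  by apply: contra nA1 => A'F; rewrite (ocfaces_card_inj FM A'F A1F) // cA' cA1.
pose G := A' |: (F :\ A1).
have compA' Y : Y \in F -> Y != A1 -> (A' \subset Y) || (Y \subset A').
  move=> YF YA1; have [j cY _] := PB_rank (sP Y YF); have eY := lvlE FM YF cY.
  have [ji|ij|e] := ltngtP j i.
  - by rewrite -eY (subset_trans (lvl_sub F ji)) ?orbT.
  - by rewrite -eY (subset_trans A'C) //; apply: lvl_sub.
  - case/eqP: YA1; apply: (ocfaces_card_inj FM YF A1F); by rewrite cY cA1 e.
have GM : G \in M.
  apply/ocfacesP; split.
  - apply/subsetP => Y; rewrite in_setU1 in_setD1 => /orP[/eqP->|/andP[_ /sP//]].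
    rewrite in_setD A'P andbT !inE negb_or -cards_eq0 cA' muln_eq0 /=.
    apply: contraTneq (ltn_ord i) => e; move: cS; rewrite -e cA' => /eqP.
    by rewrite eqn_pmul2l // eqSS => /eqP->; rewrite ltnn.
  - move=> X Y; rewrite !inE => /orP[/eqP->|/andP[XA1 XF]] /orP[/eqP->|/andP[YA1 YF]].
    + by rewrite subxx.
    + exact: compA'.
    + by rewrite orbC; exact: compA'.
    + exact: ch.
  by rewrite cardsU1 !inE (negPf A'F) andbF add1n -cF (cardsD1 A1 F) A1F.
exists G => //; split.
  apply/setP => Y; rewrite !inE; have [->|YA'] /= := eqVneq Y A'.
    rewrite (negPf A'F) /=; apply/negbTE/forall_inPn; exists i; rewrite ?inE // cA' eqxx //.
  have [->|//] := eqVneq Y A1; rewrite A1F /=; apply/esym/negbTE/forall_inPn.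
  by exists i; rewrite ?inE // cA1 eqxx.
have eG j : j != i.+1 -> j <= q.+2 -> lvl G j = lvl F j.
  move=> ji jq; case: (lvlP FM jq) ji => [->|l lF|->]; rewrite ?lvl0 ?lvlS // => li.
  apply: (lvlE GM); last by rewrite (lvl_card FM (leqW (ltn_ord l))).
  rewrite !inE lF andbT orbC; apply/orP; left; apply: contra li => /eqP/(congr1 (fun X => #|X|)).
  by move/eqP; rewrite (lvl_card FM (leqW (ltn_ord l))) cA1 eqn_pmul2l.
have eG1 : lvl G i.+1 = A' by apply: (lvlE GM); rewrite ?setU11.
have iq2 : i < q.+2 by rewrite ltnW.
apply: (face_weight_lex (p := i) GM FM) => //.
  by move=> j ji; apply: eG; [rewrite ltn_eqF|apply: leq_trans i2].
rewrite eG1 (eG i) ?ltn_eqF //.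
by apply: (first_edge_weight BS Ed A'C CP fe) => //;
  [exact: lvl_Phat|rewrite cA1 cA mulnS addnC].
Qed.

(** Between their first disagreement and the next common level, [F] and [G] differ only at ranks of
    [X], where [F] has no descent. By [rising_first_edge] the step of [F] there is the first one, so
    its label beats that of [G]. *)
Lemma descents_first F G (X : {set 'I_q.+1}) : F \in M -> G \in M -> G != F ->
  erase X G = erase X F -> [disjoint X & descents F] -> (face_weight F < face_weight G)%N.
Proof.
move=> FM GM GF eX dX.
have [j0 j0q j0P] : exists2 j : nat, j <= q.+2 & lvl F j != lvl G j.
  case: (pickP (fun i : 'I_q.+1 => lvl F i.+1 != lvl G i.+1)) => [i iP|no].
    by exists i.+1 => //; rewrite ltnW // ltnS.
  by case/eqP: GF; apply: (lvl_inj GM FM) => i; apply/esym/eqP/negbFE/no.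
have [] := ex_minnP (ex_intro (fun j => lvl F j != lvl G j) j0 j0P).
case=> [|p] pP pmin; first by rewrite !lvl0 ?eqxx in pP.
have pq : p.+1 < q.+2.
  rewrite ltn_neqAle (leq_trans (pmin _ j0P)) // andbT.
  by apply: contraNneq pP => ->; rewrite !lvlS.
have eqp j : j <= p -> lvl F j = lvl G j.
  by move=> jp; apply/eqP; apply: contraLR jp => /pmin; rewrite -ltnNge.
have eS : p + (q.+2 - p).-1.+1 = q.+2 by move: pq; clear; lia.
(* Level [p + n.+1] is the first common level after [p]; it exists since both chains end at [S]. *)
have [n /eqP en nmin] : exists2 n, lvl F (p + n.+1) == lvl G (p + n.+1) &
    forall n', lvl F (p + n'.+1) == lvl G (p + n'.+1) -> n <= n'.
  have ex_n : exists n, lvl F (p + n.+1) == lvl G (p + n.+1).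
    by exists (q.+2 - p).-1; rewrite eS !lvlS.
  by have [n en nmin] := ex_minnP ex_n; exists n.
have pn : p + n.+1 <= q.+2.
  by rewrite -[X in _ <= X]eS leq_add2l ltnS; apply: nmin; rewrite eS !lvlS.
have rise i : (i.+1 < n.+1)%N -> ~~ falls B (lvl F (p + i)) (lvl F (p + i.+1)) (lvl F (p + i.+2)).
  rewrite ltnS => lt.
  have ltq : p + i < q.+1 by move: lt pn; clear; lia.
  have ne : lvl F (p + i.+1) != lvl G (p + i.+1).
    by apply: contraTneq lt => e; rewrite -leqNgt; apply: nmin; rewrite e.
  have iX : Ordinal ltq \in X.
    apply: contraNT ne => niX; rewrite addnS.
    by rewrite -(erase_lvl GM FM eX niX).
  have := disjointFr dX iX; rewrite inE /= !addnS => ->.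
  by [].
have [c [a [b Ed]]] := flag_edge BS (lvl_flag FM pn) (ltn0Sn n).
have fe := rising_first_edge BS CH (lvl_flag FM pn) (ltn0Sn n) rise Ed.
move: Ed fe; rewrite addn0 addn1 => Ed fe.
have pq' : p <= q.+2 by rewrite ltnW // ltnW.
apply: (@face_weight_lex F G p) => //; first exact: ltnW.
rewrite -(eqp p (leqnn p)).
have sub : p.+1 <= p + n.+1 by rewrite addnS ltnS leq_addr.
apply: (first_edge_weight BS Ed _ _ fe); rewrite ?lvl_Phat //.
- exact: lvl_sub.
- exact: ltnW.
- by rewrite (eqp p (leqnn p)); apply: lvl_sub.
- by rewrite en; apply: lvl_sub.
- by rewrite !lvl_card // ?mulnS 1?addnC // ltnW.
- by rewrite eq_sym.
Qed.

Lemma erase1E F (i : 'I_q.+1) : F \in M -> erase [set i] F = F :\ lvl F i.+1.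
Proof.
move=> FM; have ci := lvl_card FM (leqW (ltn_ord i)).
apply/setP => Y; rewrite !inE andbC; case: (boolP (Y \in F)) => [YF|]; rewrite ?andbF //.
rewrite !andbT; apply/forall_inP/idP => [H|YL j].
  by apply: contraTneq (H i (set11 i)) => ->; rewrite ci negbK.
rewrite inE => /eqP->; apply: contra YL => /eqP cY.
by rewrite (lvlE FM YF cY).
Qed.

Lemma erase1_ocfaces F (i : 'I_q.+1) : F \in M -> erase [set i] F \in ocfaces P q.
Proof.
move=> FM; have /ocfacesP[sP ch cF] := FM.
rewrite erase1E //; apply/ocfacesP; split.
- exact: subset_trans (subsetDl _ _) sP.
- by move=> X Y; rewrite !in_setD1 => /andP[_ XF] /andP[_ YF]; exact: ch.
- by move: cF; rewrite (cardsD1 (lvl F i.+1)) lvl_mem // => -[].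
Qed.

(** * The boundary matrix and the dimension of top homology *)

Local Open Scope ring_scope.

Definition bd_entry (G d : {set {set 'I_N}}) : rat :=
  if d \subset G then
    match [pick x in G :\: d] with
    | Some x => (-1) ^+ #|[set y in G | y \proper x]|
    | None => 0
    end
  else 0.

(** The sign depends on the erased face only: the vertices of [G] below the removed one are those of
    smaller cardinality, and they survive in the face. *)
Lemma bd_entryE F G (i : 'I_q.+1) : F \in M -> G \in M ->
  bd_entry G (erase [set i] F) =
  (erase [set i] G == erase [set i] F)%:R *
  (-1) ^+ #|[set y in erase [set i] F | (#|y| < 2 * i.+1)%N]|.
Proof.
move=> FM GM; rewrite /bd_entry.
have -> : (erase [set i] F \subset G) = (erase [set i] G == erase [set i] F).
  apply/idP/eqP => [sG|<-]; last by apply/subsetP => Y; rewrite inE => /andP[].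
  apply/esym/eqP; rewrite eqEcard; apply/andP; split.
    apply/subsetP => Y YF; rewrite inE (subsetP sG) //.
    by move: YF; rewrite inE => /andP[].
  have /ocfacesP[_ _ ->] := erase1_ocfaces i FM.
  by have /ocfacesP[_ _ ->] := erase1_ocfaces i GM.
case: eqP => [<-|_]; last by rewrite mul0r.
rewrite mul1r erase1E //; set X := lvl G i.+1.
have XG : X \in G by exact: lvl_mem.
have cX : #|X| = (2 * i.+1)%N by rewrite lvl_card // leqW.
have e : G :\: (G :\ X) = [set X].
  by apply/setP => Y; rewrite !inE; case: eqP => [->|_]; rewrite ?XG // andNb.
rewrite e; case: pickP => [Y|/(_ X)]; last by rewrite inE eqxx.
rewrite inE => /eqP->; congr (_ ^+ #|pred_of_set _|); apply/setP => Z; rewrite !inE -cX.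
case: (boolP (Z \in G)) => ZG; rewrite ?andbF //= andbT.
have /ocfacesP[_ ch _] := GM.
apply/idP/andP => [ZX|[ZX lt]].
  by split; [apply: contraTneq ZX => ->; rewrite properxx|exact: proper_card].
rewrite properEcard lt andbT; case/orP: (ch Z X ZG XG) => // /subset_leq_card.
by rewrite leqNgt lt.
Qed.

(** Up to sign, each class sum is the boundary coefficient at the common face [erase [set i] F]. *)
Lemma bdmx_kernel (f : {set {set 'I_N}} -> rat) :
  (\row_j f (enum_val (A := M) j)) *m bdmx P q = 0 <->
  forall F i, F \in M -> class_sum M erase f i F = 0.
Proof.
have entry j : ((\row_j f (enum_val (A := M) j)) *m bdmx P q) 0 j =
    \sum_(G in M) f G * bd_entry G (enum_val j).
  rewrite mxE [RHS]big_enum_val; apply: eq_bigr => l _.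
  by rewrite !mxE.
have class d F i : F \in M -> d = erase [set i] F -> exists s : rat, s != 0 /\
    \sum_(G in M) f G * bd_entry G d = class_sum M erase f i F * s.
  move=> FM ->; eexists; split; last first.
    rewrite /class_sum mulr_suml big_mkcondr /=; apply: eq_bigr => G GM.
    rewrite bd_entryE //; case: eqP => _; last by rewrite mul0r mulr0.
    by rewrite mul1r.
  by rewrite signr_eq0.
split=> [f0 F i FM|f0].
  have dM := erase1_ocfaces i FM.
  have /matrixP/(_ 0 (enum_rank_in dM (erase [set i] F))) := f0.
  rewrite entry enum_rankK_in // [RHS]mxE => H.
  have [s [s0 e]] := class _ F i FM erefl.
  by move/eqP: H; rewrite e mulf_eq0 (negPf s0) orbF => /eqP.
(* A face inside no member of [M] gives a zero column; any other one misses exactly one vertex of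
   some [F], whose rank is [i]. *)
apply/rowP => j; rewrite entry [RHS]mxE; set d := enum_val j.
have /ocfacesP[dP _ cd] : d \in ocfaces P q := enum_valP j.
case: (pickP [pred F in M | d \subset F]) => [F /andP[FM dF]|no]; last first.
  by rewrite big1 // => G GM; have := no G; rewrite /= GM /bd_entry /= => ->; rewrite mulr0.
have [_ _ cF] := ocfacesP _ _ FM.
have /cards1P[X eX] : #|F :\: d| == 1%N by rewrite cardsDS // cF cd subSnn.
have : X \in F :\: d by rewrite eX set11.
rewrite inE => /andP[Xd XF]; have /subsetP/(_ X XF)/PB_rank[i cX _] : F \subset P by case/ocfacesP: FM.
have ed : d = erase [set i] F.
  apply/eqP; rewrite eqEcard; have /ocfacesP[_ _ ->] := erase1_ocfaces i FM; rewrite cd leqnn andbT.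
  apply/subsetP => Y Yd; rewrite erase1E // (lvlE FM XF cX) in_setD1 (subsetP dF) // andbT.
  by apply: contraNneq Xd => <-.
by have [s [_ ->]] := class d F i FM ed; rewrite f0 // mul0r.
Qed.

(** There are no faces with [q.+2] vertices, hence no boundaries, and the homology is the kernel. *)
Lemma reduced_betti_falling :
  reduced_betti P q = #|[set F in M | descents F == setT]|.
Proof.
rewrite /reduced_betti (rank_class_kernel erase_sub descents_down descents_first bdmx_kernel).
rewrite (_ : \rank (bdmx P q.+1) = 0%N) ?subn0 //.
by apply/eqP; rewrite -leqn0 (leq_trans (rank_leq_row _)) // ocfaces_top cards0.
Qed.

End Faces.

(** * Chains with descents at all ranks and alternating B-permutations *)

Section Bijection.
Variables (N : nat) (S : {set 'I_N}) (B : {set {set 'I_N}}) (q : nat).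
Hypotheses (BS : building_set S B) (CH : chordal B).
Hypotheses (cS : #|S| = (2 * q.+2)%N) (SP : S \in Phat S B).
Variable x0 : 'I_N.
Implicit Types (I J A C D K X : {set 'I_N}) (x y z a b c m : 'I_N).
Implicit Types (t : #|S|.-tuple 'I_N) (F : {set {set 'I_N}}).
Local Notation conn := (conn B).
Local Notation edge := (edge S B).
Local Notation P := (PB S B).
Local Notation M := (ocfaces P q.+1).

Lemma BpermP t : reflect
  [/\ uniq t, [set x in t] = S &
   forall i, i < #|S| -> exists2 y, y \in conn [set x in take i.+1 t] (nth x0 t i) &
     forall z, z \in take i.+1 t -> (z <= y)%N]
  (Bperm S B t).
Proof.
have step (i : 'I_#|S|) : [set x in t] = S ->
    reflect (exists2 y, y \in conn [set x in take i.+1 t] (nth x0 t i) &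
       forall z, z \in take i.+1 t -> (z <= y)%N)
     [exists C in components (restr B [set x in take i.+1 t]),
        (tnth t i \in C) &&
        [exists y in C, [forall z in [set x in take i.+1 t], (nat_of_ord z <= nat_of_ord y)%N]]].
  move=> tS; have XS : [set x in take i.+1 t] \subset S.
    apply/subsetP => x; have := congr1 (fun X : {set _} => x \in X) tS.
    by rewrite /= !inE => <-; exact: mem_take.
  have iX : nth x0 t i \in [set x in take i.+1 t].
    rewrite inE (take_nth x0) ?size_tuple // mem_rcons inE eqxx //.
  rewrite (tnth_nth x0); apply: (iffP exists_inP).
    case=> C /(componentsP BS _ XS)[x xX ->] /andP[ix /exists_inP[y yC /forall_inP ym]].
    exists y; first by rewrite (conn_eq BS XS xX ix).
    by move=> z zX; apply: ym; rewrite inE.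
  case=> y yC ym; exists (conn [set x in take i.+1 t] (nth x0 t i)).
    by apply/(componentsP BS _ XS); exists (nth x0 t i).
  rewrite (conn_self BS) //=; apply/exists_inP; exists y => //.
  by apply/forall_inP => z; rewrite inE; exact: ym.
apply: (iffP andP) => [[pe /forallP H]|[ut tS H]].
  have tS : [set x in t] = S.
    by apply/setP => x; rewrite inE (perm_mem pe) mem_enum.
  split=> [||i iS] //; first by rewrite (perm_uniq pe) enum_uniq.
  by have /(step (Ordinal iS) tS) := H (Ordinal iS).
split.
  apply: uniq_perm; rewrite ?enum_uniq // => x.
  by have := congr1 (fun X : {set _} => x \in X) tS; rewrite /= inE mem_enum.
by apply/forallP => i; apply/(step i tS); exact: H.
Qed.

Lemma alternatingP t : reflect
  (forall i, i.+1 < #|S| ->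
     if odd i then (nth x0 t i < nth x0 t i.+1)%N else (nth x0 t i.+1 < nth x0 t i)%N)
  (alternating t).
Proof.
apply: (iffP forallP) => [H i lt|H i].
  have := forallP (H (Ordinal (ltnW lt))) (Ordinal lt).
  by rewrite /= eqxx !(tnth_nth x0).
apply/forallP => j; apply/implyP => /eqP e; rewrite !(tnth_nth x0) e.
by apply: H; rewrite -e.
Qed.

Definition prefix (s : seq 'I_N) i : {set 'I_N} := [set x in take (2 * i) s].

Definition chain_of (s : seq 'I_N) : {set {set 'I_N}} := [set prefix s (val i).+1 | i : 'I_q.+1].

Lemma prefix0 s : prefix s 0 = set0.
Proof. by rewrite /prefix muln0 take0; apply/setP => x; rewrite !inE. Qed.

Lemma prefixS s i : 2 * i.+1 <= size s ->
  prefix s i.+1 = [set nth x0 s (2 * i); nth x0 s (2 * i).+1] :|: prefix s i.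
Proof.
rewrite /prefix mulnS add2n => lt; apply/setP => x; rewrite !inE.
rewrite (take_nth x0) // (take_nth x0); last exact: ltnW.
by rewrite !(mem_rcons, inE) orbCA orbA.
Qed.

Lemma card_prefix s i : uniq s -> 2 * i <= size s -> #|prefix s i| = 2 * i.
Proof.
move=> us le; rewrite cardsE (card_uniqP _) ?take_uniq // size_take_min.
exact/minn_idPl.
Qed.

Lemma prefix_sub s i j : i <= j -> prefix s i \subset prefix s j.
Proof.
move=> ij; apply/subsetP => x; rewrite !inE => H.
have le : 2 * i <= 2 * j by rewrite leq_pmul2l.
by move: H; rewrite -(take_takel s le); exact: mem_take.
Qed.

Lemma chain_of_lvl s i : chain_of s \in M -> uniq s -> [set x in s] = S ->
  size s = 2 * q.+2 -> i <= q.+2 -> lvl S (chain_of s) i = prefix s i.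
Proof.
move=> FM us sS ss le.
case: i le => [|i]; first by rewrite (lvl0 FM) prefix0.
rewrite ltnS leq_eqVlt => /orP[/eqP->|lt].
  by rewrite (lvlS BS cS FM) /prefix -ss take_size.
apply: (lvlE BS cS FM); first by apply/imsetP; exists (Ordinal lt).
by rewrite card_prefix // ss leq_pmul2l // ltnW.
Qed.

(* Both elements of a step join the component of the maximum, so that
   component absorbs the odd one created by [a]. *)
Lemma edge_of_step A a b y y' : A \in Phat S B -> a \in S -> b \in S ->
  a \notin A -> b \notin A -> (b < a)%N ->
  y \in conn (a |: A) a -> (forall z, z \in a |: A -> (z <= y)%N) ->
  y' \in conn ([set a; b] :|: A) b -> (forall z, z \in [set a; b] :|: A -> (z <= y')%N) ->
  edge A ([set a; b] :|: A) y a b /\ (forall z, z \in [set a; b] :|: A -> (z <= y)%N).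
Proof.
move=> AP aS bS aA bA ba yD ym; set A' := _ :|: A => yD' ym'.
have AS := PhatS BS AP.
have A'S : A' \subset S by rewrite !subUset !sub1set aS bS.
have aA' : a \in A' by rewrite !inE eqxx.
have bA' : b \in A' by rewrite !inE eqxx orbT.
have sA : a |: A \subset A' by apply: setSU; rewrite sub1set set21.
have ym2 z : z \in A' -> (z <= y)%N.
  rewrite !inE => /orP[/orP[]/eqP->|zA].
  - by apply: ym; rewrite setU11.
  - by apply: leq_trans (ltnW ba) _; apply: ym; rewrite setU11.
  - by apply: ym; rewrite setU1r.
have y'A' := subsetP (conn_sub B A' b) _ yD'.
have yA' := subsetP sA _ (subsetP (conn_sub B _ _) _ yD).
(* Both are the maximum of [A'], which forces [a] and [b] into one component. *)
have eyy : y' = y by apply/val_inj/eqP; rewrite eqn_leq ym2 // ym'.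
have yDa : y \in conn A' a by apply: (subsetP (connS B a sA)).
have eab : conn A' b = conn A' a.
  by rewrite -(conn_eq BS A'S aA' yDa) -(conn_eq BS A'S bA' yD') eyy.
have [_ Aev] := PhatP BS _ AP.
have xC x : x \in A' -> x \notin conn A' a -> conn A' x \subset A.
  move=> xA' xD; apply/subsetP => z zx; have := subsetP (conn_sub B A' x) _ zx.
  rewrite !inE => /orP[/orP[]/eqP E|//]; case/negP: xD; subst z.
    by rewrite (conn_eq BS A'S xA' zx) (conn_self BS).
  by rewrite -eab (conn_eq BS A'S xA' zx) (conn_self BS).
have exC x : x \in A' -> x \notin conn A' a -> conn A' x = conn A x.
  move=> xA' xD; apply/eqP; rewrite eqEsubset [X in _ && X]connS ?subsetUr // andbT.
  by apply: conn_max; rewrite ?(conn_in BS) ?(conn_self BS) ?xC.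
have inA x : x \in A' -> x \notin conn A' a -> x \in A.
  by move=> xA' xD; apply: (subsetP (xC x xA' xD)); exact: (conn_self BS).
have ev : ~~ odd #|A' :\: conn A' a|.
  apply: (even_closed BS AP) => [|x /setDP[xA' xD]].
    by apply/subsetP => x /setDP[]; exact: inA.
  apply/subsetP => z; rewrite -exC // => zx.
  rewrite inE (subsetP (conn_sub B A' x)) // andbT; apply: contra xD => zD.
  by rewrite -(conn_eq BS A'S aA' zD) (conn_eq BS A'S xA' zx) (conn_self BS).
(* [A'] is even like [A], and so is its part outside this component. *)
have evD : ~~ odd #|conn A' a|.
  have cA' : #|A'| = #|A| + 2.
    have := cardsUI [set a; b] A; rewrite cards2 neq_ltn ba orbT.
    have -> : [set a; b] :&: A = set0.
      apply/setP => x; rewrite !inE; apply/negbTE/negP => /andP[/orP[]/eqP-> h].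
        by rewrite h in aA.
      by rewrite h in bA.
    by rewrite cards0 addn0 addnC => ->; rewrite addnC.
  have /(congr1 odd) := cardsID (conn A' a) A'.
  rewrite (setIidPr (conn_sub B A' a)) cA' !oddD (negPf ev) (negPf (Phat_even BS AP)) /=.
  by rewrite addbF => ->.
have A'P : A' \in Phat S B.
  apply/(PhatP BS); split=> // x xA'.
  have [xD|xD] := boolP (x \in conn A' a); first by rewrite (conn_eq BS A'S aA' xD).
  by rewrite exC // Aev // inA.
split=> //; split=> //; first by rewrite -eab (conn_self BS).
split=> // z zD; apply: ym2; exact: (subsetP (conn_sub B A' a)).
Qed.

Section FromTuple.
Variable t : #|S|.-tuple 'I_N.
Hypotheses (tB : Bperm S B t) (tA : alternating t).

(** Induction on prefixes: the conditions at positions [2 * j] and [(2 * j).+1] feed [edge_of_step],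
    which also keeps the prefix in [Phat S B]. The label is the maximum of the whole prefix. *)
Lemma tuple_edge i : i < q.+2 -> exists2 y,
  edge (prefix t i) (prefix t i.+1) y (nth x0 t (2 * i)) (nth x0 t (2 * i).+1) &
  forall z, z \in prefix t i.+1 -> (z <= y)%N.
Proof.
have [ut tS tM] := BpermP _ tB; have tAl := alternatingP _ tA.
have PP : forall j, j <= q.+2 -> (forall i, i < j -> exists2 y,
  edge (prefix t i) (prefix t i.+1) y (nth x0 t (2 * i)) (nth x0 t (2 * i).+1) &
  forall z, z \in prefix t i.+1 -> (z <= y)%N) /\ prefix t j \in Phat S B.
  elim=> [|j IH] jq.
    by rewrite prefix0 (set0_Phat BS).
  have [IH1 AP] := IH (ltnW jq).
  suff [y Ed ym] : exists2 y,
    edge (prefix t j) (prefix t j.+1) y (nth x0 t (2 * j)) (nth x0 t (2 * j).+1) &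
    forall z, z \in prefix t j.+1 -> (z <= y)%N.
    have [_ A'P _ _ _] := Ed.
    split=> // l; rewrite ltnS leq_eqVlt => /orP[/eqP->|]; [by exists y|exact: IH1].
  have lt2 : (2 * j).+1 < #|S|.
    by rewrite cS -add2n -mulnS leq_pmul2l.
  have st : size t = #|S| by rewrite size_tuple.
  have lt1 : 2 * j < #|S| by exact: ltnW.
  have memS l : l < #|S| -> nth x0 t l \in S.
    move=> h; have := congr1 (fun X : {set _} => nth x0 t l \in X) tS.
    by rewrite /= inE => <-; rewrite mem_nth ?st.
  have npre r : 2 * j <= r -> r < #|S| -> nth x0 t r \notin prefix t j.
    move=> ji rS; rewrite inE; apply/negP => /(nthP x0)[l].
    rewrite size_take_min st leq_min => /andP[l1 l2]; rewrite nth_take // => /eqP.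
    by rewrite nth_uniq ?st // => /eqP e; rewrite e ltnNge ji in l1.
  have e1 : [set x in take (2 * j).+1 t] = nth x0 t (2 * j) |: prefix t j.
    by apply/setP => x; rewrite (take_nth x0) ?st // !inE mem_rcons inE.
  have e2 : [set x in take (2 * j).+2 t] = prefix t j.+1.
    by rewrite /prefix mulnS.
  have [y yD ym] := tM _ lt1; have [y' yD' ym'] := tM _ lt2.
  rewrite e1 in yD; rewrite e2 in yD'.
  have eS : prefix t j.+1 = [set nth x0 t (2 * j); nth x0 t (2 * j).+1] :|: prefix t j.
    by apply: prefixS; rewrite st mulnS.
  have := tAl (2 * j) lt2; rewrite mul2n odd_double -mul2n => ba.
  have [|||Ed ym2] := edge_of_step AP (memS _ lt1) (memS _ lt2)
      (npre _ (leqnn _) lt1) (npre _ (leqnSn _) lt2) ba yD (y' := y').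
  - by move=> z; rewrite -e1 inE; exact: ym.
  - by rewrite -eS.
  - by move=> z; rewrite -eS -e2 inE; exact: ym'.
  by exists y; rewrite eS.
by move=> iq; have [H _] := PP q.+2 (leqnn _); exact: H.
Qed.

Lemma chain_of_ocfaces : chain_of t \in M.
Proof.
have [ut tS _] := BpermP _ tB.
have st : size t = 2 * q.+2 by rewrite size_tuple.
have cp i : i <= q.+2 -> #|prefix t i| = 2 * i.
  by move=> le; rewrite card_prefix // st leq_pmul2l.
apply/ocfacesP; split.
- apply/subsetP => X /imsetP[i _ ->].
  have iq : i.+1 <= q.+2 by rewrite ltnS ltnW.
  have [y [_ XP _ _ _] _] := @tuple_edge i iq.
  rewrite in_setD XP andbT !inE negb_or -cards_eq0 cp //=.
  apply: contraTneq (ltn_ord i) => e; have := cp i.+1 iq; rewrite e cS => /eqP.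
  by rewrite eqn_pmul2l // eqSS => /eqP<-; rewrite ltnn.
- move=> X Y /imsetP[i _ ->] /imsetP[j _ ->].
  by case/orP: (leq_total i j) => h; rewrite (prefix_sub t (h : _.+1 <= _.+1)) ?orbT.
rewrite card_imset ?card_ord // => i j /(congr1 (fun X => #|X|)) /eqP.
have h (l : 'I_q.+1) : l.+1 <= q.+2 by rewrite ltnS ltnW.
by rewrite /= !(cp _ (h _)) eqn_pmul2l // eqSS => /eqP/val_inj.
Qed.

Lemma chain_of_tuple_lvl i : i <= q.+2 -> lvl S (chain_of t) i = prefix t i.
Proof.
have [ut tS _] := BpermP _ tB.
by apply: chain_of_lvl => //; [exact: chain_of_ocfaces|rewrite size_tuple].
Qed.

(** Labels are prefix maxima, so they weakly increase; on equality, the ascent at position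
    [(2 * i).+1] is the required [b_i < a_(i+1)]. *)
Lemma chain_of_descents : descents S B q (chain_of t) == setT.
Proof.
rewrite eqEsubset subsetT; apply/subsetP => i _; rewrite inE.
have iq := ltn_ord i.
rewrite !chain_of_tuple_lvl; [|exact: iq|by rewrite ltnW|by rewrite ltnW // ltnW].
have [y Ed ym] := tuple_edge (ltnW iq : i < q.+2).
have [y' Ed' ym'] := tuple_edge (iq : i.+1 < q.+2).
rewrite /falls (lcmpE BS Ed) (lbotE Ed) (lcmpE BS Ed') (ltopE Ed').
have [_ _ _ _ [yD _]] := Ed.
have : (y <= y')%N.
  by apply: ym'; apply: (subsetP (edge_sub Ed')); exact: (subsetP (conn_sub _ _ _) _ yD).
rewrite leq_eqVlt => /orP[/eqP e|->//]; rewrite e eqxx ltnn /=.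
have := alternatingP _ tA (2 * i).+1; rewrite mulnS add2n /= mul2n odd_double /= -mul2n.
apply; rewrite cS; move: iq; clear; lia.
Qed.
End FromTuple.

(** Step [i] contributes its top at position [2 * i] and its bottom right after. [insubd] returns
    numeric labels to ['I_N]; on an [edge] the default [x0] never occurs. *)
Definition seq_of F : nat -> 'I_N := fun j =>
  insubd x0 (if odd j then lbot (lvl S F j./2) (lvl S F j./2.+1)
             else ltop (lvl S F j./2) (lvl S F j./2.+1)).

Definition tuple_of F : #|S|.-tuple 'I_N := [tuple of mkseq (seq_of F) #|S|].

Lemma seq_of_edge F i c a b : edge (lvl S F i) (lvl S F i.+1) c a b ->
  seq_of F (2 * i) = a /\ seq_of F (2 * i).+1 = b.
Proof.
move=> Ed; rewrite /seq_of /= mul2n odd_double /= uphalf_double half_double.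
by rewrite (ltopE Ed) (lbotE Ed) !valKd.
Qed.

Lemma chain_ofK t : Bperm S B t -> alternating t -> tuple_of (chain_of t) = t.
Proof.
move=> tB tA; apply: eq_from_tnth => j; rewrite !(tnth_nth x0) /= nth_mkseq //.
have jq : j./2 < q.+2 by have := ltn_ord j; rewrite [X in _ < X]cS; move: (val j); clear; lia.
have [y Ed _] := tuple_edge tB tA jq.
move: (Ed); rewrite -!chain_of_tuple_lvl //; last by rewrite ltnW.
move=> /seq_of_edge[e1 e2].
have := odd_double_half j; rewrite -mul2n; case: (odd j) => /= e; rewrite -e.
  exact: e2.
exact: e1.
Qed.

Section FromChain.
Variable F : {set {set 'I_N}}.
Hypotheses (FM : F \in M) (FD : descents S B q F = setT).

(** Descents at all ranks make [c] weakly increase, so it dominates the earlier levels as well as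
    the two new elements. *)
Lemma chain_edge i : i < q.+2 -> exists2 c,
  edge (lvl S F i) (lvl S F i.+1) c (seq_of F (2 * i)) (seq_of F (2 * i).+1) &
  forall z, z \in lvl S F i.+1 -> (z <= c)%N.
Proof.
have E j : j < q.+2 -> exists c,
    edge (lvl S F j) (lvl S F j.+1) c (seq_of F (2 * j)) (seq_of F (2 * j).+1).
  move=> jq; have [|c [a [b Ed]]] := flag_edge BS (@lvl_flag _ _ _ _ BS cS SP F j 1 FM _) (ltnSn 0).
    by rewrite addn1.
  by move: Ed; rewrite addn0 addn1 => Ed; have [-> ->] := seq_of_edge Ed; exists c.
elim: i => [|i IH] iq.
  have [c Ed] := E _ iq; exists c => // z; have [_ _ _ bD [_ cm]] := Ed.
  have [_ A'P [eA _ _ _] _ _] := Ed.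
  have aA' : seq_of F (2 * 0) \in lvl S F 1 by rewrite eA !inE eqxx.
  rewrite {1}eA (lvl0 FM) setU0 !inE => /orP[]/eqP->; apply: cm => //.
  exact: (conn_self BS (PhatS BS A'P)).
have [c Ed cm] := IH (ltnW iq); have [c' Ed'] := E _ iq; exists c' => // z.
have : Ordinal (iq : i < q.+1) \in descents S B q F by rewrite FD inE.
rewrite inE /falls /= (lcmpE BS Ed) (lcmpE BS Ed') => H.
have cc : (c <= c')%N by case/orP: H => [/ltnW//|/andP[/eqP->]].
have [_ A'P [eA _ _ _] bD [_ cm']] := Ed'.
rewrite eA !inE => /orP[zab|/cm zc]; last exact: leq_trans cc.
have aA' : seq_of F (2 * i.+1) \in lvl S F i.+2 by rewrite eA !inE eqxx.
by case/orP: zab => /eqP->; apply: cm' => //; exact: (conn_self BS (PhatS BS A'P)).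
Qed.

Lemma prefix_mkseq n i : 2 * i <= n -> i <= q.+2 -> prefix (mkseq (seq_of F) n) i = lvl S F i.
Proof.
elim: i => [|i IH] le iq.
  by rewrite prefix0 (lvl0 FM).
rewrite prefixS ?size_mkseq // IH; [|by apply: leq_trans le; rewrite leq_pmul2l|exact: ltnW].
have [c [_ _ [-> _ _ _] _ _] _] := chain_edge iq.
have le2 : (2 * i).+1 < n by rewrite mulnS in le.
by rewrite !nth_mkseq //; exact: ltnW.
Qed.

(** After an odd position the prefix is a full level, where [b] is connected to [c]; after an even
    one it is [a |: A], where chordality connects [a] to [c]. *)
Lemma tuple_of_Bperm : Bperm S B (tuple_of F).
Proof.
have sS : [set x in tuple_of F] = S.
  transitivity (prefix (mkseq (seq_of F) #|S|) q.+2).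
    by rewrite /prefix take_oversize // size_mkseq cS.
  by rewrite prefix_mkseq ?cS // (lvlS BS cS FM).
apply/BpermP; split=> //.
  apply/card_uniqP; rewrite size_tuple; transitivity #|[set x in tuple_of F]|.
    by rewrite cardsE.
  by rewrite sS.
move=> j jS.
have jq : j./2 < q.+2 by move: jS; rewrite cS; clear; lia.
have [c Ed cm] := chain_edge jq; have [_ A'P [eA _ _ ba] bD [cD cm']] := Ed.
have A'S := PhatS BS A'P.
set A := lvl S F j./2 in Ed eA; set A' := lvl S F _ in Ed cm A'P eA bD cD cm' A'S.
set a := seq_of F (2 * j./2) in Ed eA ba bD cD cm'.
have aA' : a \in A' by rewrite eA !inE eqxx.
have eA0 : [set x in take (2 * j./2) (mkseq (seq_of F) #|S|)] = A.
  by apply: prefix_mkseq; [rewrite cS leq_pmul2l|]; exact: ltnW.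
have eA1 : [set x in take (2 * j./2.+1) (mkseq (seq_of F) #|S|)] = A'.
  by apply: prefix_mkseq; rewrite // cS leq_pmul2l.
rewrite nth_mkseq //=.
have := odd_double_half j; rewrite -mul2n; case: (odd j) => /= e; rewrite ?add0n ?add1n in e.
  rewrite -[X in take X.+1]e -[X in seq_of F X]e.
  have -> : (2 * j./2).+2 = 2 * j./2.+1 by rewrite mulnS.
  exists c; first by rewrite eA1 (conn_eq BS A'S aA' bD).
  by move=> z zX; apply: cm; rewrite -eA1 inE.
have eX : [set x in take j.+1 (mkseq (seq_of F) #|S|)] = a |: A.
  apply/setP => x; rewrite (take_nth x0) ?size_mkseq // !inE mem_rcons inE nth_mkseq //.
  by rewrite -eA0 !inE e /a e.
have sX : a |: A \subset A' by rewrite eA setSU // sub1set set21.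
have ac : (a <= c)%N by apply: cm.
exists c; last first.
  move=> z zX; apply: cm; apply: (subsetP sX); by rewrite -eX inE.
(* The only element of [A'] outside [a |: A] is [b], and it is below [a]. *)
rewrite eX -e -/a; apply: (suffix_conn BS CH sX A'S (setU11 _ _)) => //.
move=> z zD az; have := subsetP (conn_sub _ _ _) _ zD.
rewrite eA !inE => /orP[/orP[->//|/eqP ez]|->]; last by rewrite orbT.
by move: ba; rewrite -ez ltnNge az.
Qed.

Lemma tuple_of_alternating : alternating (tuple_of F).
Proof.
apply/alternatingP => j jS; rewrite !nth_mkseq //; last exact: ltnW.
have jq : j./2 < q.+2 by move: jS; rewrite cS; clear; lia.
have [c Ed cm] := chain_edge jq; have [_ A'P [eA _ _ ba] bD [cD cm']] := Ed.
have := odd_double_half j; rewrite -mul2n; case: (odd j) => /= e; rewrite ?add0n ?add1n in e.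
  rewrite -e.
  have jq' : j./2.+1 < q.+2 by move: jS; rewrite -e cS; clear; lia.
  have -> : (2 * j./2).+2 = 2 * j./2.+1 by rewrite mulnS.
  have [c2 Ed2 cm2] := chain_edge jq'.
  have : Ordinal (jq' : j./2 < q.+1) \in descents S B q F by rewrite FD inE.
  rewrite inE /falls /= (lcmpE BS Ed) (lcmpE BS Ed2) (lbotE Ed) (ltopE Ed2).
  case/orP=> [lt|/andP[]//].
  (* If [c < c2], then [c2] is not in the earlier level, so it is one of the two new elements; hence
     the new top exceeds [c], which is at least the old bottom. *)
  have [_ _ [eA2 _ _ ba2] _ [cD2 _]] := Ed2.
  have c2A := subsetP (conn_sub _ _ _) _ cD2.
  have [aA' bA'] : seq_of F (2 * j./2) \in lvl S F j./2.+1 /\ seq_of F (2 * j./2).+1 \in lvl S F j./2.+1.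
    by rewrite eA !inE !eqxx orbT.
  have bc := cm _ bA'.
  move: c2A; rewrite eA2 !inE => /orP[/orP[]/eqP ec|/cm]; last by rewrite leqNgt lt.
    by rewrite -ec; exact: leq_ltn_trans lt.
  by apply: ltn_trans ba2; rewrite -ec; exact: leq_ltn_trans lt.
by rewrite -e.
Qed.

Lemma tuple_ofK : chain_of (tuple_of F) = F.
Proof.
have tB := tuple_of_Bperm; have tA := tuple_of_alternating.
apply: (lvl_inj BS cS) => //; first exact: chain_of_ocfaces.
move=> i; have iq : i.+1 <= q.+2 by rewrite ltnS ltnW.
by rewrite chain_of_tuple_lvl // /tuple_of prefix_mkseq // cS leq_pmul2l.
Qed.
End FromChain.

(** [tuple_of] and [chain_of] invert each other on these sets, so each is injective there and
    neither cardinality exceeds the other. *)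
Lemma card_falling_num_alt :
  #|[set F in M | descents S B q F == setT]| = num_alt_Bperm S B.
Proof.
rewrite /num_alt_Bperm; apply/eqP; rewrite eqn_leq; apply/andP; split.
  rewrite -(card_in_imset (f := tuple_of)); last first.
    move=> F G; rewrite in_set => /andP[FM /eqP FD]; rewrite in_set => /andP[GM /eqP GD] e.
    by rewrite -(tuple_ofK FM FD) e tuple_ofK.
  apply/subset_leq_card/subsetP => t /imsetP[F]; rewrite in_set => /andP[FM /eqP FD] ->.
  by rewrite inE tuple_of_Bperm // tuple_of_alternating.
rewrite -(card_in_imset (f := fun t : #|S|.-tuple 'I_N => chain_of t)); last first.
  move=> t u; rewrite !inE => /andP[tB tA] /andP[uB uA] e.
  by rewrite -(chain_ofK tB tA) e chain_ofK.
apply/subset_leq_card/subsetP => F /imsetP[t]; rewrite inE => /andP[tB tA] ->.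
by rewrite in_set chain_of_ocfaces // chain_of_descents.
Qed.

End Bijection.

Theorem theorem4p4 (N : nat) (S : {set 'I_N}) (B : {set {set 'I_N}}) (k : nat) :
  building_set S B ->
  chordal B ->
  #|S| = (2 * k)%N ->
  (2 <= k)%N ->
  (forall C, C \in components B -> ~~ odd #|C|) ->
  reduced_betti (PB S B) (k - 2) = num_alt_Bperm S B.
Proof.
move=> BS CH; case: k => [|[|q]] // cS _ Cev; rewrite subSS subSS subn0.
(* The parity assumption on the components of [B] says exactly this, because [restr B S = B]. *)
have SP : S \in Phat S B.
  rewrite inE subxx; apply/forall_inP => C.
  rewrite (_ : restr B S = B); first exact: Cev.
  apply/setP => J; rewrite inE; case: (boolP (J \in B)) => //= JB.
  by have [/(_ J JB)/andP[]] := BS.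
have /card_gt0P[x0 _] : 0 < #|S| by rewrite cS.
rewrite (reduced_betti_falling BS CH cS SP).
exact: card_falling_num_alt.
Qed.
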